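(* Let $M$ be a CR-submanifold of a locally conformal Kähler manifold $(\overline{M},J,\overline{g})$, with holomorphic distribution $D$, totally real distribution $D^\perp$, and normal bundle decomposition $TM^\perp=JD^\perp\oplus\mu$. Then the following assertions are equivalent: (i) $M$ is a totally real ruled CR-submanifold. (ii) $M$ is $D^\perp$-geodesic, and the anti-Lee form $\theta$ and the second fundamental form $h$ of $M$ are related by $$\theta(Y)JX=2h_{JD^\perp}(X,Y),\quad \forall X\in\Gamma(D^\perp),\ Y\in\Gamma(D).$$ (iii) The second fundamental form $h$, the anti-Lee form $\theta$ and the anti-Lee vector field $A$ satisfy $$\theta(Y)JX=2h_{JD^\perp}(X,Y),\quad \forall X\in\Gamma(D^\perp),\ Y\in\Gamma(D),$$ $$h(X,Z)\in\Gamma(\mu),\quad \forall X,Z\in\Gamma(D^\perp),$$ and $$\left(\nabla_X^\perp JZ\right)_\mu=-\frac{1}{2}g(X,Z)A_\mu,\quad \forall X,Z\in\Gamma(D^\perp).$$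
   Context: An almost Hermitian manifold $(\overline{M},J,\overline{g})$ is locally conformal Kähler (l.c.K.) if each point has an open neighbourhood $U$ and a positive function $f_U$ on $U$ such that $\exp(-f_U)\overline{g}_{|U}$ is Kähler. Put $\Omega(X,Y)=\overline{g}(X,JY)$. The Lee form $\omega$ is the globally defined closed 1-form with $\omega_{|U}=df_U$; it satisfies $d\Omega=\omega\wedge\Omega$. The Lee vector field $B$ is defined by $\overline{g}(X,B)=\omega(X)$. The anti-Lee form is $\theta=\omega\circ J$ and the anti-Lee vector field is $A=-JB$. With $\overline{\nabla}$ the Levi-Civita connection of $\overline{g}$, the l.c.K. condition is equivalent to $$(\overline{\nabla}_XJ)Y=\tfrac{1}{2}\left[\theta(Y)X-\omega(Y)JX-\overline{g}(X,Y)A-\Omega(X,Y)B\right].$$ A submanifold $M$ of $\overline{M}$ (with induced metric $g$) is a CR-submanifold if there is a differentiable distribution $D\subset TM$ with $JD_p=D_p$ for all $p\in M$ (holomorphic distribution) whose orthogonal complement $D^\perp$ in $TM$ satisfies $JD^\perp_p\subset T_p^\perp M$ for all $p$ (totally real distribution). So $TM=D\oplus D^\perp$ and $TM^\perp=JD^\perp\oplus\mu$, where $\mu$ is the orthogonal complement of $JD^\perp$ in the normal bundle $TM^\perp$. Subscripts $JD^\perp$ and $\mu$ denote the components in these subbundles; in particular $h_{JD^\perp}$ is the $JD^\perp$-component of $h$, and $A_\mu$ is the $\mu$-component of $A$ along $M$. $h$ is the second fundamental form of $M$ and $\nabla^\perp$ the normal connection: $\overline{\nabla}_XY=\nabla_XY+h(X,Y)$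 and $\overline{\nabla}_XN=-a_NX+\nabla^\perp_XN$ for $X,Y$ tangent and $N$ normal to $M$, where $\nabla$ is the Levi-Civita connection of $(M,g)$ and $a_N$ is the shape operator. $M$ is $D^\perp$-geodesic if $h(X,Y)=0$ for all $X,Y\in\Gamma(D^\perp)$. The distribution $D^\perp$ is always integrable (known result of Blair and Chen); the resulting foliation of $M$ is denoted $\mathfrak{F}^\perp$ and called the canonical totally real foliation. $M$ is a totally real ruled CR-submanifold if the leaves of $\mathfrak{F}^\perp$ are totally geodesic immersed in $(\overline{M},\overline{g})$. *)

(* Defs.v *)
From HB Require Import structures.
From mathcomp Require Import all_boot all_order all_algebra.
From mathcomp Require Import all_classical all_reals all_analysis.

Set Implicit Arguments.
Unset Strict Implicit.
Unset Printing Implicit Defensive.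

Import Order.TTheory GRing.Theory Num.Theory.
Import numFieldNormedType.Exports.

Local Open Scope classical_set_scope.
Local Open Scope ring_scope.

(** * Smooth functions of several variables *)

(* Only meaningful for [U] open. *)
Fixpoint Ck_on (R : realType) (n : nat) (W : normedModType R) (k : nat)
    (U : set 'rV[R]_n) (f : 'rV[R]_n -> W) : Prop :=
  match k with
  | 0 => forall y, U y -> {for y, continuous f}
  | k'.+1 => (forall y, U y -> differentiable f y) /\
             (forall v, Ck_on k' U (fun y => 'D_v f y))
  end.

Definition Cinf_on (R : realType) (n : nat) (W : normedModType R)
    (U : set 'rV[R]_n) (f : 'rV[R]_n -> W) : Prop :=
  forall k, Ck_on k U f.

(** * Smooth manifolds *)

Record chart (R : realType) (n : nat) (T : topologicalType) := Chart {
  dom : set T;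
  coord : T -> 'rV[R]_n;
  param : 'rV[R]_n -> T;
  dom_open : open dom;
  codom_open : open (coord @` dom);
  coord_continuous : forall x, dom x -> {for x, continuous coord};
  param_continuous :
    forall y, (coord @` dom) y -> {for y, continuous param};
  coordK : forall x, dom x -> param (coord x) = x
}.

(* The atlas is indexed by the points of the manifold: [chart_at p] is a chart
   around [p].  Every smooth structure is generated by such an atlas. *)
Record manifold (R : realType) (n : nat) := Manifold {
  carrier :> topologicalType;
  manifold_hausdorff : hausdorff_space carrier;
  manifold_second_countable : @second_countable carrier;
  chart_at : carrier -> chart R n carrier;
  chart_at_dom : forall p, dom (chart_at p) p;
  chart_at_compat : forall p q : carrier,
    Cinf_on (coord (chart_at p) @` (dom (chart_at p) `&` dom (chart_at q)))
            (coord (chart_at q) \o param (chart_at p))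
}.

Definition msmooth_on (R : realType) (n : nat) (M : manifold R n)
    (W : normedModType R) (U : set M) (F : M -> W) : Prop :=
  forall p : M, Cinf_on (coord (chart_at p) @` (dom (chart_at p) `&` U))
                        (F \o param (chart_at p)).

(** ** Tangent vectors

   A tangent vector at [x] is a row vector in 'rV[R]_n: its components in the
   coordinates of the chart [chart_at x].  A linear endomorphism or a bilinear
   form on the tangent space at [x] is a matrix, [v *m L] being the image of [v]
   under [L], and a 1-form is a column vector. *)

(* Differential at [x] of a function with values in a normed space. *)
Definition fdiff (R : realType) (n : nat) (M : manifold R n)
    (W : normedModType R) (F : M -> W) (x : M) (v : 'rV[R]_n) : W :=
  'd (F \o param (chart_at x)) (coord (chart_at x) x) v.

(* Tangent map, from the tangent space at [x] to the one at [f x]. *)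
Definition tmap (R : realType) (m n : nat) (M : manifold R m)
    (N : manifold R n) (f : M -> N) (x : M) (v : 'rV[R]_m) : 'rV[R]_n :=
  fdiff (coord (chart_at (f x)) \o f) x v.

Definition smooth_map (R : realType) (m n : nat) (M : manifold R m)
    (N : manifold R n) (f : M -> N) : Prop :=
  continuous f /\
  forall q : N, msmooth_on (f @^-1` dom (chart_at q)) (coord (chart_at q) \o f).

Definition immersion (R : realType) (m n : nat) (M : manifold R m)
    (N : manifold R n) (f : M -> N) : Prop :=
  smooth_map f /\ forall x, injective (tmap f x).

(* Components, in the chart at [q], of a tangent vector [v] at [x]. *)
Definition comp_in (R : realType) (n : nat) (N : manifold R n) (q x : N)
    (v : 'rV[R]_n) : 'rV[R]_n :=
  fdiff (coord (chart_at q)) x v.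

(* The rows are the coordinate vector fields of the chart at [q], taken at [x]. *)
Definition frame (R : realType) (n : nat) (N : manifold R n) (q x : N) :
    'M[R]_n :=
  \matrix_(i < n)
    'd (coord (chart_at x) \o param (chart_at q)) (coord (chart_at q) x)
      (delta_mx 0 i : 'rV[R]_n).

(* Smooth vector fields along [f], on an open set [U]: [V x] is tangent to [N]
   at [f x]. *)
Definition field_along_on (R : realType) (m n : nat) (M : manifold R m)
    (N : manifold R n) (f : M -> N) (U : set M) (V : M -> 'rV[R]_n) : Prop :=
  forall q : N,
    msmooth_on (U `&` f @^-1` dom (chart_at q))
               (fun x => comp_in q (f x) (V x)).

Definition vector_field_on (R : realType) (n : nat) (M : manifold R n)
    (U : set M) (X : M -> 'rV[R]_n) : Prop :=
  field_along_on (fun x : M => x) U X.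

Definition vector_field (R : realType) (n : nat) (M : manifold R n)
    (X : M -> 'rV[R]_n) : Prop :=
  vector_field_on [set: M] X.

(** * Riemannian metrics and the Levi-Civita connection *)

Definition inner (R : realType) (n : nat) (G : 'M[R]_n) (u v : 'rV[R]_n) : R :=
  (u *m G *m v^T) 0 0.

Definition form_app (R : realType) (n : nat) (a : 'cV[R]_n) (v : 'rV[R]_n) : R :=
  (v *m a) 0 0.

(* Gram matrix of [g] in the coordinate fields of the chart at [q]. *)
Definition metric_comp (R : realType) (n : nat) (N : manifold R n)
    (g : N -> 'M[R]_n) (q x : N) : 'M[R]_n :=
  frame q x *m g x *m (frame q x)^T.

Definition riemannian_on (R : realType) (n : nat) (N : manifold R n)
    (U : set N) (g : N -> 'M[R]_n) : Prop :=
  [/\ forall x, U x -> forall u v, inner (g x) u v = inner (g x) v u,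
      forall x, U x -> forall u, u != 0 -> 0 < inner (g x) u u &
      forall q, msmooth_on (U `&` dom (chart_at q)) (metric_comp g q)].

(* Christoffel symbols Gamma^k_ij in the chart at [q], at coordinates [y]:
   1/2 g^kl (d_i g_jl + d_j g_il - d_l g_ij). *)
Definition christoffel (R : realType) (n : nat) (N : manifold R n)
    (g : N -> 'M[R]_n) (q : N) (y : 'rV[R]_n) (i j k : 'I_n) : R :=
  let G z := metric_comp g q (param (chart_at q) z) in
  let dG (a b c : 'I_n) : R :=
    'D_(delta_mx 0 a : 'rV[R]_n) (fun z => G z b c : R^o) y in
  2^-1 * \sum_(l < n) invmx (G y) k l * (dG i j l + dG j i l - dG l i j).

(* Levi-Civita derivative at [x], in the direction [u], of a vector field [V]
   along [f], computed in the chart at [f x].  By the transformation law of the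
   Christoffel symbols it does not depend on the chart. *)
Definition cov (R : realType) (m n : nat) (M : manifold R m) (N : manifold R n)
    (g : N -> 'M[R]_n) (f : M -> N) (u : 'rV[R]_m) (V : M -> 'rV[R]_n) (x : M) :
    'rV[R]_n :=
  let q := f x in
  fdiff (fun x' => comp_in q (f x') (V x')) x u +
  \row_(k < n) \sum_(i < n) \sum_(j < n)
    christoffel g q (coord (chart_at q) q) i j k * tmap f x u 0 i * V x 0 j.

(** * Locally conformal Kaehler manifolds *)

Definition endo_comp (R : realType) (n : nat) (N : manifold R n)
    (J : N -> 'M[R]_n) (q x : N) : 'M[R]_n :=
  frame q x *m J x *m invmx (frame q x).

Definition almost_hermitian_on (R : realType) (n : nat) (N : manifold R n)
    (U : set N) (J g : N -> 'M[R]_n) : Prop :=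
  [/\ riemannian_on U g,
      forall q, msmooth_on (U `&` dom (chart_at q)) (endo_comp J q),
      forall x, U x -> J x *m J x = - 1%:M &
      forall x, U x -> forall u v,
        inner (g x) (u *m J x) (v *m J x) = inner (g x) u v].

(* Kaehler: almost Hermitian with J parallel for the Levi-Civita connection. *)
Definition kaehler_on (R : realType) (n : nat) (N : manifold R n)
    (U : set N) (J g : N -> 'M[R]_n) : Prop :=
  almost_hermitian_on U J g /\
  forall X Y, vector_field_on U X -> vector_field_on U Y -> forall x, U x ->
    cov g (fun z : N => z) (X x) (fun z => Y z *m J z) x =
    cov g (fun z : N => z) (X x) Y x *m J x.

Definition conformal_kaehler_on (R : realType) (n : nat) (N : manifold R n)
    (J g : N -> 'M[R]_n) (U : set N) (f : N -> R) : Prop :=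
  [/\ open U, msmooth_on U (f : N -> R^o), forall x, U x -> 0 < f x &
      kaehler_on U J (fun x => expR (- f x) *: g x)].

Definition lck (R : realType) (n : nat) (N : manifold R n)
    (J g : N -> 'M[R]_n) : Prop :=
  almost_hermitian_on [set: N] J g /\
  forall p : N, exists (U : set N) (f : N -> R),
    U p /\ conformal_kaehler_on J g U f.

(* [omega] is globally defined and equals df_U on the members of a cover by open
   sets U carrying conformal factors f_U. *)
Definition lee_form (R : realType) (n : nat) (N : manifold R n)
    (J g : N -> 'M[R]_n) (omega : N -> 'cV[R]_n) : Prop :=
  forall p : N, exists (U : set N) (f : N -> R),
    [/\ U p, conformal_kaehler_on J g U f &
        forall x, U x -> forall v,
          form_app (omega x) v = fdiff (f : N -> R^o) x v].

Definition lee_vector (R : realType) (n : nat) (N : manifold R n)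
    (g : N -> 'M[R]_n) (omega : N -> 'cV[R]_n) (B : N -> 'rV[R]_n) : Prop :=
  forall x v, inner (g x) v (B x) = form_app (omega x) v.

Definition anti_lee_form (R : realType) (n : nat) (N : manifold R n)
    (J : N -> 'M[R]_n) (omega : N -> 'cV[R]_n) (x : N) (v : 'rV[R]_n) : R :=
  form_app (omega x) (v *m J x).

Definition anti_lee_vector (R : realType) (n : nat) (N : manifold R n)
    (J : N -> 'M[R]_n) (B : N -> 'rV[R]_n) (x : N) : 'rV[R]_n :=
  - (B x *m J x).

(** * Immersed submanifolds *)

(* Orthogonal projection onto a linear subspace [S], for the inner product
   [G]. *)
Definition orth_proj (R : realType) (n : nat) (G : 'M[R]_n)
    (S : set 'rV[R]_n) (w : 'rV[R]_n) : 'rV[R]_n :=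
  xget 0 [set s | S s /\ forall t, S t -> inner G (w - s) t = 0].

Definition tangent_space (R : realType) (m n : nat) (M : manifold R m)
    (N : manifold R n) (f : M -> N) (x : M) : set 'rV[R]_n :=
  range (tmap f x).

Definition normal_space (R : realType) (m n : nat) (M : manifold R m)
    (N : manifold R n) (g : N -> 'M[R]_n) (f : M -> N) (x : M) :
    set 'rV[R]_n :=
  [set w | forall t, tangent_space f x t -> inner (g (f x)) w t = 0].

Definition push (R : realType) (m n : nat) (M : manifold R m)
    (N : manifold R n) (f : M -> N) (Y : M -> 'rV[R]_m) : M -> 'rV[R]_n :=
  fun x => tmap f x (Y x).

(* The normal component of the ambient derivative (Gauss formula). *)
Definition second_ff (R : realType) (m n : nat) (M : manifold R m)
    (N : manifold R n) (g : N -> 'M[R]_n) (f : M -> N)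
    (X Y : M -> 'rV[R]_m) (x : M) : 'rV[R]_n :=
  orth_proj (g (f x)) (normal_space g f x) (cov g f (X x) (push f Y) x).

(* The normal component of the ambient derivative (Weingarten formula); [V] is a
   normal field along [f]. *)
Definition normal_conn (R : realType) (m n : nat) (M : manifold R m)
    (N : manifold R n) (g : N -> 'M[R]_n) (f : M -> N)
    (X : M -> 'rV[R]_m) (V : M -> 'rV[R]_n) (x : M) : 'rV[R]_n :=
  orth_proj (g (f x)) (normal_space g f x) (cov g f (X x) V x).

Definition totally_geodesic (R : realType) (m n : nat) (M : manifold R m)
    (N : manifold R n) (g : N -> 'M[R]_n) (f : M -> N) : Prop :=
  forall X Y, vector_field X -> vector_field Y ->
    forall x, second_ff g f X Y x = 0.

(** * Distributions and CR-submanifolds *)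

Definition distribution (R : realType) (m : nat) (M : manifold R m) (r : nat)
    (D : M -> {vspace 'rV[R]_m}) : Prop :=
  forall p : M, exists (U : set M) (E : 'I_r -> M -> 'rV[R]_m),
    [/\ open U, U p, forall i, vector_field_on U (E i) &
        forall x, U x -> \dim (D x) = r /\
                         D x = <<[seq E i x | i <- enum 'I_r]>>%VS].

(* The induced metric on [M] is the pull-back of [g] along [f]. *)
Definition induced_metric (R : realType) (m n : nat) (M : manifold R m)
    (N : manifold R n) (g : N -> 'M[R]_n) (f : M -> N) (x : M)
    (u v : 'rV[R]_m) : R :=
  inner (g (f x)) (tmap f x u) (tmap f x v).

Definition Dperp (R : realType) (m n : nat) (M : manifold R m)
    (N : manifold R n) (g : N -> 'M[R]_n) (f : M -> N)
    (D : M -> {vspace 'rV[R]_m}) (x : M) : set 'rV[R]_m :=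
  [set v | forall u, u \in D x -> induced_metric g f x u v = 0].

Definition JDperp (R : realType) (m n : nat) (M : manifold R m)
    (N : manifold R n) (J g : N -> 'M[R]_n) (f : M -> N)
    (D : M -> {vspace 'rV[R]_m}) (x : M) : set 'rV[R]_n :=
  [set tmap f x v *m J (f x) | v in Dperp g f D x].

Definition mu_space (R : realType) (m n : nat) (M : manifold R m)
    (N : manifold R n) (J g : N -> 'M[R]_n) (f : M -> N)
    (D : M -> {vspace 'rV[R]_m}) (x : M) : set 'rV[R]_n :=
  [set w | normal_space g f x w /\
           forall t, JDperp J g f D x t -> inner (g (f x)) w t = 0].

Definition CR_submanifold (R : realType) (m n : nat) (M : manifold R m)
    (N : manifold R n) (J g : N -> 'M[R]_n) (f : M -> N) (r : nat)
    (D : M -> {vspace 'rV[R]_m}) : Prop :=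
  [/\ immersion f, distribution r D,
      forall x, [set tmap f x v *m J (f x) | v in [set` D x]] =
                [set tmap f x v | v in [set` D x]] &
      forall x, JDperp J g f D x `<=` normal_space g f x].

Definition section_D (R : realType) (m : nat) (M : manifold R m)
    (D : M -> {vspace 'rV[R]_m}) (X : M -> 'rV[R]_m) : Prop :=
  vector_field X /\ forall x, X x \in D x.

Definition section_Dperp (R : realType) (m n : nat) (M : manifold R m)
    (N : manifold R n) (g : N -> 'M[R]_n) (f : M -> N)
    (D : M -> {vspace 'rV[R]_m}) (X : M -> 'rV[R]_m) : Prop :=
  vector_field X /\ forall x, Dperp g f D x (X x).

Definition Dperp_geodesic (R : realType) (m n : nat) (M : manifold R m)
    (N : manifold R n) (g : N -> 'M[R]_n) (f : M -> N)
    (D : M -> {vspace 'rV[R]_m}) : Prop :=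
  forall X Y, section_Dperp g f D X -> section_Dperp g f D Y ->
    forall x, second_ff g f X Y x = 0.

(* The foliation integrating a distribution [E]: a partition of [M] into
   connected, injectively immersed integral manifolds of [E].  Since the leaves
   cover [M], each of them is automatically a maximal connected integral
   manifold, so by Frobenius there is exactly one such foliation when [E] is
   integrable. *)
Record foliation (R : realType) (m : nat) (M : manifold R m)
    (E : M -> set 'rV[R]_m) (k : nat) := Foliation {
  leaf_index : Type;
  leaf : leaf_index -> manifold R k;
  leaf_map : forall a, leaf a -> M;
  leaf_immersion : forall a, immersion (@leaf_map a);
  leaf_injective : forall a, injective (@leaf_map a);
  leaf_connected : forall a, connected [set: leaf a];
  leaf_partition : forall x : M, exists! a, range (@leaf_map a) x;
  leaf_tangent : forall a (y : leaf a),
    tangent_space (@leaf_map a) y = E (leaf_map y)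
}.

Definition totally_real_ruled (R : realType) (m n k : nat) (M : manifold R m)
    (N : manifold R n) (g : N -> 'M[R]_n) (f : M -> N)
    (E : M -> set 'rV[R]_m) (F : foliation E k) : Prop :=
  forall a : leaf_index F, totally_geodesic g (f \o @leaf_map _ _ _ _ _ F a).

(* Main.v *)
Require Import Defs.
From HB Require Import structures.
From mathcomp Require Import all_boot all_order all_algebra.
From mathcomp Require Import all_classical all_reals all_analysis.
From mathcomp Require Import perm ring lra.
Import Order.TTheory GRing.Theory Num.Theory.
Import numFieldNormedType.Exports.
Local Open Scope classical_set_scope.
Local Open Scope ring_scope.
Set Implicit Arguments.
Unset Strict Implicit.
Unset Printing Implicit Defensive.

(* Let iota be the inclusion of a leaf of the totally real foliation and
   phi = f o iota.  For fields U, Z on the leaf and a section Y of D,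
   differentiating g(J phi_*Z, f_*Y) = 0 along the leaf and using the l.c.K.
   formula for nabla J gives
     g(nabla_U phi_*Z, J f_*Y)
       = g(J phi_*Z, h(U, Y)) - (1/2) theta(Y) g(U, Z).
   Modulo vectors tangent to M, nabla_U phi_*Z is h(U, Z).  So the leaf is
   totally geodesic exactly when h vanishes on D^perp and the right-hand side
   vanishes, which is (ii).  For nu in mu the same formula gives
     g(nabla^perp_X JZ, nu) = - g(h(X, Z), J nu) - (1/2) g(X, Z) g(A, nu),
   and mu is J-invariant, so that the last condition of (iii) says that h(X, Z)
   is orthogonal to mu.  All terms are tensorial; bump functions extend tangent
   vectors to global sections of TM, D and D^perp. *)

(** The formula for the derivative of J is not part of the definition of l.c.K. used here: the
    definition only provides local metrics exp(-f_U) g for whose Levi-Civita connections J is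
    parallel. Read in a chart, this says that the coordinate derivative of J is a commutator of J
    with the Christoffel form of exp(-f_U) g. That derivative does not see the metric, so passing to
    the Christoffel form of g leaves exactly the terms in omega, theta, A and B.

    Condition (i) speaks of fields on a leaf, (ii) and (iii) of global sections over M, and a field
    on an injectively immersed leaf need not be the restriction of a field on M. Derivatives are
    therefore taken along maps, and a leaf field is compared with a section that agrees with it at a
    single point.

    From (ii) to (i), tangency to M is not enough: the derivative must be tangent to the leaf. Its
    D-component is detected by the vectors J f_*Y because J D = D, and the mixed condition makes
    that component vanish. *)

Local Notation coord := Defs.coord.
Local Notation distribution := Defs.distribution.
Local Notation normal_space := Defs.normal_space.
Local Notation dm q := (dom (chart_at q)).
Local Notation cd q := (coord (chart_at q)).
Local Notation pm q := (param (chart_at q)).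
Local Notation incl a := (@leaf_map _ _ _ _ _ _ a).

(** * Differentials *)

Section NearDiff.
Variables (R : numFieldType) (V W : normedModType R).

(** Identities between charts hold only near a point, on the overlap of the domains. Since the
    first-order expansion depends only on the germ, differentials can be carried across them. *)
Lemma near_eq_differentiable (f g : V -> W) (x : V) :
  (\near x, f x = g x) -> differentiable f x ->
  differentiable g x /\ 'd g x = 'd f x :> (V -> W).
Proof.
move=> fg df.
have e : g \o shift x = cst (g x) + 'd f x +o_ (0 : V) id.
  apply/eqaddoP => _/posnumP[e].
  have := diff_locally df; move/eqaddoP => /(_ e%:num) /(_ [gt0 of e%:num]).
  apply: filter_app.
  have : \forall y \near (0 : V), f (y + x) = g (y + x).
    by have := fg; rewrite (near_shift 0) /=; apply: filterS => y; rewrite subr0.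
  apply: filterS => y fgy H.
  by rewrite !fctE /= -(nbhs_singleton fg) -fgy.
have h := diff_unique (diff_continuous df) e.
split=> //; apply/diff_locallyP; rewrite h; split=> //.
exact: diff_continuous df.
Qed.

Lemma near_eq_is_diff (f g : V -> W) (df : V -> W) (x : V) :
  (\near x, f x = g x) -> is_diff x f df -> is_diff x g df.
Proof.
move=> fg [dfx <-]; have [dgx <-] := near_eq_differentiable fg dfx.
exact: DiffDef.
Qed.

Lemma is_diff_sum (I : Type) (s : seq I) (f df : I -> V -> W) (x : V) :
  (forall i, is_diff x (f i) (df i)) ->
  is_diff x (fun y => \sum_(i <- s) f i y) (fun v => \sum_(i <- s) df i v).
Proof.
move=> h; elim: s => [|i s ih].
  have -> : (fun y => \sum_(i <- [::]) f i y) = cst 0.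
    by apply/funext => y; rewrite big_nil.
  apply: is_diff_eq.
  by apply/funext => y; rewrite big_nil.
have -> : (fun y => \sum_(i <- i :: s) f i y) =
          f i + (fun y => \sum_(i <- s) f i y).
  by apply/funext => y; rewrite big_cons.
apply: (is_diff_eq (is_diffD (h i) ih)).
by apply/funext => y; rewrite big_cons.
Qed.

End NearDiff.

Lemma is_diff_bilin (R : numFieldType) (T U V W : normedModType R)
    (b : {bilinear U -> V -> W}) (f df : T -> U) (g dg : T -> V) (x : T) :
  continuous (fun p : U * V => b p.1 p.2) ->
  is_diff x f df -> is_diff x g dg ->
  is_diff x (fun y => b (f y) (g y))
            (fun v => b (df v) (g x) + b (f x) (dg v)).
Proof.
move=> bc hf hg.
have hb : is_diff (f x, g x) (fun p : U * V => b p.1 p.2)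
    (fun q => b (f x) q.2 + b q.1 (g x)).
  by split; [exact: differentiable_bilin|rewrite diff_bilin].
have -> : (fun y => b (f y) (g y)) =
          (fun p : U * V => b p.1 p.2) \o (fun y => (f y, g y)) by [].
have hp := is_diff_pair hf hg.
apply: (is_diff_eq (is_diff_comp hp hb)).
by apply/funext => v /=; rewrite addrC.
Qed.

Lemma mx_continuous (R : realType) (T : topologicalType) m n
    (f : T -> 'M[R]_(m, n)) (x : T) :
  (forall i j, {for x, continuous (fun y => f y i j)}) ->
  {for x, continuous f}.
Proof.
move=> h; apply/cvgrPdist_lt => e e0.
have : \forall y \near x, forall ij : 'I_m * 'I_n,
    `|f x ij.1 ij.2 - f y ij.1 ij.2| < e.
  apply: filter_forall => -[i j]; have /cvgrPdist_lt := h i j; exact.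
apply: filterS => y hy.
rewrite /Num.norm/= mx_normrE; apply/bigmax_ltP; split=> // ij _.
by have := hy ij; rewrite !mxE.
Qed.

Lemma cvg_sum (R : numFieldType) (W : normedModType R) (T : topologicalType)
    (I : Type) (s : seq I) (f : I -> T -> W) (x : T) :
  (forall i, {for x, continuous (f i)}) ->
  {for x, continuous (fun y => \sum_(i <- s) f i y)}.
Proof. by move=> h; apply: cvg_big => // [|i _]; [exact: add_continuous|exact: h]. Qed.

Lemma mulmx_continuous (R : realType) m p n :
  continuous (fun q : 'M[R]_(m, p) * 'M[R]_(p, n) => q.1 *m q.2).
Proof.
move=> q; apply: mx_continuous => i j.
have -> : (fun y : 'M[R]_(m, p) * 'M[R]_(p, n) => (y.1 *m y.2) i j) =
  (fun y => \sum_k y.1 i k * y.2 k j) by apply/funext => y; rewrite mxE.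
apply: cvg_sum => k.
apply: (@continuousM R _ (fun y : 'M[R]_(m, p) * 'M[R]_(p, n) => y.1 i k)
  (fun y => y.2 k j)).
- by apply: (@continuous_comp _ _ _ (fun y : 'M[R]_(m, p) * 'M[R]_(p, n) => y.1)
    (fun A : 'M[R]_(m, p) => A i k)); [exact: cvg_fst|exact: coord_continuous].
- by apply: (@continuous_comp _ _ _ (fun y : 'M[R]_(m, p) * 'M[R]_(p, n) => y.2)
    (fun A : 'M[R]_(p, n) => A k j)); [exact: cvg_snd|exact: coord_continuous].
Qed.

Section ScaleBilinear.
Variables (R : numFieldType) (W : normedModType R).
Definition scale_bil (a : R^o) (w : W) : W := a *: w.
Lemma scale_is_bilinear : bilinear_for
    (GRing.Scale.Law.clone _ _ *:%R _) (GRing.Scale.Law.clone _ _ *:%R _)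
    scale_bil.
Proof.
split=> [u'|u] a x y; rewrite /scale_bil.
- by rewrite scalerDl -scalerA.
- by rewrite scalerDr; congr (_ + _); rewrite [RHS]scalerA scalerA mulrC.
Qed.
HB.instance Definition _ := bilinear_isBilinear.Build R R^o W W _ _ scale_bil
  scale_is_bilinear.
Lemma scale_bil_continuous : continuous (fun p : R^o * W => scale_bil p.1 p.2).
Proof. exact: scale_continuous. Qed.
End ScaleBilinear.

Lemma is_diff_lin (R : numFieldType) (T V W : normedModType R)
    (L : {linear V -> W}) (f df : T -> V) (x : T) :
  continuous L -> is_diff x f df -> is_diff x (L \o f) (L \o df).
Proof.
move=> cL hf; apply: is_diff_comp.
by split; [exact: linear_differentiable|rewrite diff_lin].
Qed.

Section CoordLinear.
Variables (R : numFieldType) (m n : nat) (i : 'I_m) (j : 'I_n).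
Definition coord_lin (A : 'M[R]_(m, n)) : R^o := A i j.
Lemma coord_lin_is_linear : linear coord_lin.
Proof. by move=> a A B; rewrite /coord_lin !mxE. Qed.
HB.instance Definition _ := GRing.isLinear.Build R 'M[R]_(m, n) R^o _ coord_lin
  coord_lin_is_linear.
Lemma coord_lin_continuous : continuous coord_lin.
Proof. exact: coord_continuous. Qed.
End CoordLinear.

Lemma linear_mx_continuous (R : numFieldType) m n (W : normedModType R)
  (L : {linear 'M[R]_(m, n) -> W}) : continuous L.
Proof.
have -> : (L : _ -> _) = fun A => \sum_i \sum_j A i j *: L (delta_mx i j).
  apply/funext => A; rewrite {1}[A]matrix_sum_delta linear_sum.
  by apply: eq_bigr => i _; rewrite linear_sum; apply: eq_bigr => j _; rewrite linearZ.
move=> A; apply: cvg_sum => i; apply: cvg_sum => j.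
have FA := nbhs_filter (A : 'M[R]_(m, n)).
have h := @coord_continuous R m n i j A.
apply: cvgZr_tmp; exact: h.
Qed.

(* On ['rV[R]_n] the differential carries a canonical structure that differs
   syntactically from the one of an abstract normed space, and unifying the two
   is very slow.  [hasdiffP] crosses between them. *)
Definition generic_is_diff (K : numFieldType) (V W : normedModType K)
  (f : V -> W) (x : V) (df : V -> W) : Prop := is_diff x f df.

Definition hasdiff (R : realType) (n : nat) (W : normedModType R)
    (f : 'rV[R]_n -> W) (x : 'rV[R]_n) (df : 'rV[R]_n -> W) : Prop :=
  differentiable f x /\ 'd f x =1 df.

Section HasDiff.
Variables (R : realType) (n : nat).

Lemma hasdiffP (W : normedModType R) (f : 'rV[R]_n -> W) x df :
  hasdiff f x df <-> generic_is_diff f x df.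
Proof. by split=> -[h1 h2]; split => //; [exact/funext|move=> v; rewrite -h2]. Qed.

Lemma differentiable_hasdiff (W : normedModType R) (f : 'rV[R]_n -> W) x :
  differentiable f x -> hasdiff f x ('d f x).
Proof. by []. Qed.

Lemma hasdiff_eq (W : normedModType R) (f : 'rV[R]_n -> W) x df dg :
  hasdiff f x df -> df =1 dg -> hasdiff f x dg.
Proof. by move=> [h1 h2] h; split=> // v; rewrite h2. Qed.

Lemma hasdiff_derive (W : normedModType R) (f : 'rV[R]_n -> W) x df v :
  hasdiff f x df -> 'D_v f x = df v.
Proof. by move=> [h1 h2]; rewrite deriveE. Qed.

Lemma near_hasdiff (W : normedModType R) (f g : 'rV[R]_n -> W) x df :
  (\near x, f x = g x) -> hasdiff f x df -> hasdiff g x df.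
Proof. by move=> fg /hasdiffP h; apply/hasdiffP; exact: near_eq_is_diff h. Qed.

Lemma hasdiff_sum (W : normedModType R) (I : Type) (s : seq I)
    (f df : I -> 'rV[R]_n -> W) x :
  (forall i, hasdiff (f i) x (df i)) ->
  hasdiff (fun y => \sum_(i <- s) f i y) x (fun v => \sum_(i <- s) df i v).
Proof. by move=> h; apply/hasdiffP/is_diff_sum => i; apply/hasdiffP. Qed.

Lemma hasdiff_bilin (U V W : normedModType R)
    (b : {bilinear U -> V -> W}) (f df : 'rV[R]_n -> U) (g dg : 'rV[R]_n -> V) x :
  continuous (fun p : U * V => b p.1 p.2) ->
  hasdiff f x df -> hasdiff g x dg ->
  hasdiff (fun y => b (f y) (g y)) x
          (fun v => b (df v) (g x) + b (f x) (dg v)).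
Proof.
by move=> bc /hasdiffP hf /hasdiffP hg; apply/hasdiffP; exact: is_diff_bilin.
Qed.

Lemma hasdiff_mulmx m p q (f df : 'rV[R]_n -> 'M[R]_(m, p))
    (g dg : 'rV[R]_n -> 'M[R]_(p, q)) x :
  hasdiff f x df -> hasdiff g x dg ->
  hasdiff (fun y => f y *m g y) x (fun v => df v *m g x + f x *m dg v).
Proof. exact/hasdiff_bilin/mulmx_continuous. Qed.

Lemma hasdiff_scale (W : normedModType R)
    (k dk : 'rV[R]_n -> R^o) (f df : 'rV[R]_n -> W) x :
  hasdiff k x dk -> hasdiff f x df ->
  hasdiff (fun y => k y *: f y) x (fun v => dk v *: f x + k x *: df v).
Proof. exact: (hasdiff_bilin (@scale_bil_continuous R W)). Qed.

Lemma hasdiff_lin (V W : normedModType R)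
    (L : {linear V -> W}) (f df : 'rV[R]_n -> V) x :
  continuous L -> hasdiff f x df -> hasdiff (fun y => L (f y)) x (L \o df).
Proof. by move=> cL /hasdiffP h; apply/hasdiffP; exact: is_diff_lin. Qed.

Lemma hasdiff_coord p q (f df : 'rV[R]_n -> 'M[R]_(p, q)) x i j :
  hasdiff f x df ->
  hasdiff (fun y => f y i j : R^o) x (fun v => df v i j : R^o).
Proof. exact: (hasdiff_lin (@coord_lin_continuous R p q i j)). Qed.

Lemma hasdiff_cst (W : normedModType R) (w : W) (x : 'rV[R]_n) :
  hasdiff (fun=> w) x (fun=> 0).
Proof. by apply/hasdiffP; exact: is_diff_cst. Qed.

Lemma hasdiffB (W : normedModType R) (f df g dg : 'rV[R]_n -> W) x :
  hasdiff f x df -> hasdiff g x dg ->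
  hasdiff (fun y => f y - g y) x (fun v => df v - dg v).
Proof. by move=> /hasdiffP hf /hasdiffP hg; apply/hasdiffP; exact: is_diffB. Qed.

Lemma hasdiff_id (x : 'rV[R]_n) : hasdiff id x id.
Proof. by apply/hasdiffP; exact: is_diff_id. Qed.

Lemma hasdiff_comp m (W : normedModType R) (f df : 'rV[R]_n -> 'rV[R]_m)
    (g dg : 'rV[R]_m -> W) x :
  hasdiff f x df -> hasdiff g (f x) dg ->
  hasdiff (fun y => g (f y)) x (fun v => dg (df v)).
Proof.
move=> /hasdiffP hf [/differentiableP hg1 hg2]; apply/hasdiffP.
apply: (is_diff_eq (is_diff_comp hf hg1)).
by apply/funext => v /=; exact: hg2.
Qed.

Lemma hasdiff_comp_real (a da : 'rV[R]_n -> R^o) (x : 'rV[R]_n) (e : R -> R) e' :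
  hasdiff a x da -> is_derive (a x : R) 1 e e' ->
  hasdiff (fun y => e (a y) : R^o) x (fun v => e' * da v : R^o).
Proof.
move=> /hasdiffP ha [he <-]; apply/hasdiffP.
have de : is_diff (a x : R^o) (e : R^o -> R^o) (fun v => 'D_1 e (a x) * v : R^o).
  have h := he; move/derivable1_diffP: h => h; split=> //.
  by rewrite (deriv1E he) derive1E; apply/funext => v; exact: mulrC.
exact: (is_diff_comp ha de).
Qed.

Lemma diff_sum_delta (W : normedModType R) (f : 'rV[R]_n -> W) x v :
  'd f x v = \sum_i v 0 i *: 'd f x (delta_mx 0 i).
Proof.
by rewrite {1}[v]row_sum_delta linear_sum; apply: eq_bigr => i _; rewrite linearZ.
Qed.

End HasDiff.

(** * Functions of class C^k *)

Section Ck.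
Variables (R : realType) (n : nat).
Implicit Types (U V : set 'rV[R]_n).

Lemma Ck_cong (W : normedModType R) k U (f g : 'rV[R]_n -> W) :
  open U -> (forall y, U y -> f y = g y) -> Ck_on k U f -> Ck_on k U g.
Proof.
move=> oU; elim: k f g => [|k ih] f g fg /=.
  move=> cf y Uy; have h : f @ y --> g y by rewrite -fg//; exact: cf.
  have e : \near y, f y = g y.
    by have := open_nbhs_nbhs (conj oU Uy); apply: filterS => z /fg.
  exact: cvg_trans (near_eq_cvg e) h.
move=> [df Df].
have nfg y : U y -> \forall z \near y, f z = g z.
  by move=> Uy; have := open_nbhs_nbhs (conj oU Uy); apply: filterS => z /fg.
split=> [y Uy|v].
  exact: (near_hasdiff (nfg y Uy) (differentiable_hasdiff (df y Uy))).1.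
apply: (ih _ _ _ (Df v)) => y Uy.
by apply: near_eq_derive; exact: nfg.
Qed.

Lemma Ck_sub (W : normedModType R) k U V (f : 'rV[R]_n -> W) :
  U `<=` V -> Ck_on k V f -> Ck_on k U f.
Proof.
move=> UV; elim: k f => [|k ih] f /=; first by move=> h y /UV; exact: h.
by move=> [h1 h2]; split=> [y /UV|v]; [exact: h1|exact: ih].
Qed.

Lemma Ck_local (W : normedModType R) k U (f : 'rV[R]_n -> W) :
  (forall y, U y -> exists2 V, V y & Ck_on k V f) -> Ck_on k U f.
Proof.
elim: k f => [|k ih] f /= h; first by move=> y /h[V Vy]; exact.
split; first by move=> y /h[V Vy [+ _]]; exact.
by move=> v; apply: ih => y /h[V Vy [_ hV]]; exists V.
Qed.

Lemma Ck_down (W : normedModType R) k U (f : 'rV[R]_n -> W) :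
  Ck_on k.+1 U f -> Ck_on k U f.
Proof.
elim: k f => [|k ih] f [h1 h2] /=.
  by move=> y /h1; exact: differentiable_continuous.
by split=> // v; apply: ih; exact: h2.
Qed.

Lemma Ck_cst (W : normedModType R) k U (w : W) : Ck_on k U (fun=> w).
Proof.
elim: k w => [|k ih] w /=; first by move=> y _; exact: cst_continuous.
split=> [y _|v]; first exact: differentiable_cst.
have -> : (fun y => 'D_v (fun=> w) y) = (fun=> 0).
  by apply/funext => y; exact: derive_cst.
exact: ih.
Qed.

Lemma CkD (W : normedModType R) k U (f g : 'rV[R]_n -> W) : open U ->
  Ck_on k U f -> Ck_on k U g -> Ck_on k U (fun y => f y + g y).
Proof.
move=> oU; elim: k f g => [|k ih] f g /=.
  move=> cf cg y Uy; exact: (cvgD (cf y Uy) (cg y Uy)).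
move=> [df Df] [dg Dg]; split.
  by move=> y Uy; apply: differentiableD; [exact: df|exact: dg].
move=> v; apply: (Ck_cong oU _ (ih _ _ (Df v) (Dg v))) => y Uy.
by rewrite deriveD//; apply: diff_derivable; [exact: df|exact: dg].
Qed.

(** Induction by the Leibniz rule: the derivative is a sum of two terms of the same kind, each with
    one differentiated factor and the other one lowered by [Ck_down]. Scalings and matrix products
    are instances. *)
Lemma Ck_bilin (U1 V1 W : normedModType R) (b : {bilinear U1 -> V1 -> W}) k U
   (f : 'rV[R]_n -> U1) (g : 'rV[R]_n -> V1) : open U ->
  continuous (fun p : U1 * V1 => b p.1 p.2) ->
  Ck_on k U f -> Ck_on k U g -> Ck_on k U (fun y => b (f y) (g y)).
Proof.
move=> oU bc; elim: k f g => [|k ih] f g.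
  move=> cf cg y Uy.
  apply: (@continuous_comp _ _ _ (fun y => (f y, g y)) (fun p => b p.1 p.2)).
    exact: (cvg_pair (cf y Uy) (cg y Uy)).
  exact: bc.
move=> Cf Cg; have [df Df] := Cf; have [dg Dg] := Cg.
have hd y : U y -> hasdiff (fun y => b (f y) (g y)) y
    (fun v => b ('d f y v) (g y) + b (f y) ('d g y v)).
  by move=> Uy; apply: hasdiff_bilin => //; apply: differentiable_hasdiff; [exact: df|exact: dg].
split; first by move=> y /hd hy; exact: hy.1.
move=> v.
apply: (@Ck_cong _ _ _ (fun y => b ('D_v f y) (g y) + b (f y) ('D_v g y))) => //.
  move=> y Uy; rewrite (hasdiff_derive v (hd y Uy)).
  by congr (b _ _ + b _ _); apply: deriveE; [exact: df|exact: dg].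
have [cf cg] := (Ck_down Cf, Ck_down Cg).
exact: CkD oU (ih _ _ (Df v) cg) (ih _ _ cf (Dg v)).
Qed.

Lemma Ck_scale (W : normedModType R) k U (a : 'rV[R]_n -> R^o) (f : 'rV[R]_n -> W) :
  open U -> Ck_on k U a -> Ck_on k U f -> Ck_on k U (fun y => a y *: f y).
Proof.
move=> oU; exact: (@Ck_bilin _ _ _ (@scale_bil R W) k U a f oU (@scale_bil_continuous R W)).
Qed.

Lemma Ck_mulmx m p q k U (f : 'rV[R]_n -> 'M[R]_(m, p)) (g : 'rV[R]_n -> 'M[R]_(p, q)) :
  open U -> Ck_on k U f -> Ck_on k U g -> Ck_on k U (fun y => f y *m g y).
Proof.
move=> oU; exact: (@Ck_bilin _ _ _ (@mulmx R m p q) k U f g oU (@mulmx_continuous R m p q)).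
Qed.

Lemma Ck_sum (W : normedModType R) k U (I : Type) (s : seq I)
    (f : I -> 'rV[R]_n -> W) : open U ->
  (forall i, Ck_on k U (f i)) -> Ck_on k U (fun y => \sum_(i <- s) f i y).
Proof.
move=> oU h; elim: s => [|i s ih].
  by apply: (Ck_cong oU _ (Ck_cst k U 0)) => y _; rewrite big_nil.
by apply: (Ck_cong oU _ (CkD oU (h i) ih)) => y _; rewrite big_cons.
Qed.

Lemma Ck_lin (V1 W : normedModType R) (L : {linear V1 -> W}) k U
    (f : 'rV[R]_n -> V1) : open U -> continuous L ->
  Ck_on k U f -> Ck_on k U (fun y => L (f y)).
Proof.
move=> oU cL; elim: k f => [|k ih] f.
  by move=> cf y Uy; apply: continuous_comp; [exact: cf|exact: cL].
move=> [df Df].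
have hd y : U y -> hasdiff (L \o f) y (L \o 'd f y).
  by move=> Uy; apply: hasdiff_lin => //; apply: differentiable_hasdiff; exact: df.
split; first by move=> y /hd hy; exact: hy.1.
move=> v; apply: (@Ck_cong _ _ _ (fun y => L ('D_v f y))) => //.
  move=> y Uy; rewrite (hasdiff_derive v (hd y Uy)) /=.
  by congr (L _); apply: deriveE; exact: df.
exact: ih _ (Df v).
Qed.

Lemma Ck_coord m p k U (f : 'rV[R]_n -> 'M[R]_(m, p)) i j : open U ->
  Ck_on k U f -> Ck_on k U (fun y => f y i j : R^o).
Proof.
by move=> oU; apply: (@Ck_lin _ _ (@coord_lin R m p i j)) => //; exact: coord_lin_continuous.
Qed.

End Ck.

Lemma Ck_comp (R : realType) n m (W : normedModType R) k (U : set 'rV[R]_n)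
    (V : set 'rV[R]_m) (f : 'rV[R]_n -> 'rV[R]_m) (g : 'rV[R]_m -> W) :
  open U -> (forall y, U y -> V (f y)) ->
  Ck_on k U f -> Ck_on k V g -> Ck_on k U (fun y => g (f y)).
Proof.
move=> oU UV; elim: k g => [|k ih] g.
  by move=> cf cg y Uy; apply: continuous_comp; [exact: cf|exact/cg/UV].
move=> Cf [dg Dg]; have [df Df] := Cf.
have hd y : U y -> hasdiff (g \o f) y ('d g (f y) \o 'd f y).
  move=> Uy; apply: hasdiff_comp; apply: differentiable_hasdiff; first exact: df.
  exact/dg/UV.
split; first by move=> y /hd hy; exact: hy.1.
(* Chain rule in coordinates: each summand is a component of the derivative of [f] times a partial
   derivative of [g] composed with [f], and the induction on the order applies to the latter. *)
move=> v; apply: (@Ck_cong _ _ _ _ _ (fun y => \sum_(i < m)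
   ('D_v f y 0 i : R^o) *: 'D_(delta_mx 0 i) g (f y))) => //.
  move=> y Uy; rewrite (hasdiff_derive v (hd y Uy)) /=.
  rewrite [RHS]diff_sum_delta.
  by apply: eq_bigr => i _; rewrite !deriveE//; [exact/dg/UV|exact: df].
apply: Ck_sum => // i; apply: Ck_scale => //.
  exact: (Ck_coord _ _ oU (Df v)).
exact: ih (Ck_down Cf) (Dg _).
Qed.

(** * Charts, tangent maps and frames *)

Section Chart.
Variables (R : realType) (n : nat) (T : topologicalType) (c : chart R n T).

Lemma chart_near (x : T) (P : T -> Prop) : dom c x ->
  (\near x, P x) -> \forall y \near coord c x, P (param c y).
Proof.
move=> dx Px; have cx : (coord c @` dom c) (coord c x) by exists x.
have := @param_continuous _ _ _ c _ cx.
rewrite /prop_for /continuous_at coordK//; exact.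
Qed.

Lemma chart_nearK (x : T) : dom c x ->
  \forall y \near coord c x, coord c (param c y) = y.
Proof.
move=> dx; have : nbhs (coord c x) (coord c @` dom c).
  by apply: open_nbhs_nbhs; split; [exact: codom_open|exists x].
by apply: filterS => _ [z dz <-]; rewrite coordK.
Qed.

Lemma near_dom (x : T) : dom c x -> \near x, dom c x.
Proof. by move=> dx; apply: open_nbhs_nbhs; split => //; exact: dom_open. Qed.

Lemma open_chart_image (A : set T) : open A -> open (coord c @` (dom c `&` A)).
Proof.
move=> oA; rewrite openE => _ [x [dx Ax] <-].
apply: filterS (filterI (chart_nearK dx) (chart_near dx (filterI (near_dom dx)
  (open_nbhs_nbhs (conj oA Ax))))).
by move=> y /= [? ?]; exists (param c y).
Qed.

Lemma chart_imageP (A : set T) y : (coord c @` (dom c `&` A)) y ->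
  [/\ dom c (param c y), A (param c y) & coord c (param c y) = y].
Proof. by move=> [x [dx Ax] <-]; rewrite coordK. Qed.

Lemma mem_chart_image (A : set T) x : dom c x -> A x ->
  (coord c @` (dom c `&` A)) (coord c x).
Proof. by exists x. Qed.

End Chart.

#[global] Hint Resolve chart_at_dom : core.

(** Differentiability is read in the chart at [x], the one in which [fdiff] is computed;
    [mdiff_chart] shows that any chart around [x] gives the same notion. *)
Definition mdiff (R : realType) (n : nat) (M : manifold R n)
    (W : normedModType R) (F : M -> W) (x : M) : Prop :=
  differentiable (F \o pm x) (cd x x).

Section Mdiff.
Variables (R : realType) (n : nat) (M : manifold R n).
Implicit Types (x p q : M).

Lemma coord_center x : pm x (cd x x) = x.
Proof. exact: coordK. Qed.

Lemma mdiff_hasdiff (W : normedModType R) (F : M -> W) x :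
  mdiff F x -> hasdiff (F \o pm x) (cd x x) (fdiff F x).
Proof. by []. Qed.

Lemma hasdiff_mdiff (W : normedModType R) (F : M -> W) x dF :
  hasdiff (F \o pm x) (cd x x) dF -> mdiff F x /\ fdiff F x =1 dF.
Proof. by []. Qed.

Lemma near_fdiff (W : normedModType R) (F G : M -> W) x :
  (\near x, F x = G x) -> mdiff G x -> mdiff F x /\ fdiff F x =1 fdiff G x.
Proof.
move=> FG /mdiff_hasdiff dG; apply: hasdiff_mdiff.
apply: near_hasdiff dG.
have : \near x, G x = F x by apply: filterS FG => z ->.
by move=> /(chart_near (chart_at_dom x)); exact.
Qed.

Lemma fdiff_mulmx a b c (F : M -> 'M[R]_(a, b)) (G : M -> 'M[R]_(b, c)) x :
  mdiff F x -> mdiff G x -> mdiff (fun z => F z *m G z) x /\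
  fdiff (fun z => F z *m G z) x =1
    fun v => fdiff F x v *m G x + F x *m fdiff G x v.
Proof.
move=> /mdiff_hasdiff hF /mdiff_hasdiff hG.
have := hasdiff_mdiff (F := fun z => F z *m G z) (hasdiff_mulmx hF hG).
by rewrite /= coord_center.
Qed.

Lemma fdiff_lin (V W : normedModType R) (L : {linear V -> W}) (F : M -> V) x :
  continuous L -> mdiff F x ->
  mdiff (fun z => L (F z)) x /\ fdiff (fun z => L (F z)) x =1 L \o fdiff F x.
Proof.
move=> cL /mdiff_hasdiff hF.
exact: (hasdiff_mdiff (F := fun z => L (F z)) (hasdiff_lin cL hF)).
Qed.

Lemma fdiffB (W : normedModType R) (F G : M -> W) x : mdiff F x -> mdiff G x ->
  mdiff (fun z => F z - G z) x /\
  fdiff (fun z => F z - G z) x =1 fun v => fdiff F x v - fdiff G x v.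
Proof.
move=> /mdiff_hasdiff hF /mdiff_hasdiff hG.
exact: (hasdiff_mdiff (F := fun z => F z - G z) (hasdiffB hF hG)).
Qed.

Lemma fdiff_scale (W : normedModType R) (F : M -> R^o) (G : M -> W) x :
  mdiff F x -> mdiff G x -> mdiff (fun z => F z *: G z) x /\
  fdiff (fun z => F z *: G z) x =1
    fun v => fdiff F x v *: G x + F x *: fdiff G x v.
Proof.
move=> /mdiff_hasdiff hF /mdiff_hasdiff hG.
have := hasdiff_mdiff (F := fun z => F z *: G z) (hasdiff_scale hF hG).
by rewrite /= coord_center.
Qed.

Lemma fdiff_sum (W : normedModType R) (I : Type) (s : seq I) (F : I -> M -> W) x :
  (forall i, mdiff (F i) x) -> mdiff (fun z => \sum_(i <- s) F i z) x /\
  fdiff (fun z => \sum_(i <- s) F i z) x =1 fun v => \sum_(i <- s) fdiff (F i) x v.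
Proof.
move=> h; apply: (hasdiff_mdiff (F := fun z => \sum_(i <- s) F i z)).
exact: (hasdiff_sum s (fun i => mdiff_hasdiff (h i))).
Qed.

Lemma fdiff_coord a b (F : M -> 'M[R]_(a, b)) x i j : mdiff F x ->
  mdiff (fun z => F z i j : R^o) x /\
  fdiff (fun z => F z i j : R^o) x =1 fun v => fdiff F x v i j.
Proof.
move=> /mdiff_hasdiff h.
exact: (hasdiff_mdiff (F := fun z => F z i j : R^o) (hasdiff_coord i j h)).
Qed.

Lemma fdiff_cst (W : normedModType R) (w : W) x v : fdiff (fun _ : M => w) x v = 0.
Proof. by have [_] := hasdiff_cst w (cd x x); apply. Qed.

Lemma transition_diff p q x : dm p x -> dm q x ->
  differentiable (cd q \o pm p) (cd p x).
Proof.
move=> px qx; have [+ _] := chart_at_compat p q 1.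
by apply; apply: mem_chart_image.
Qed.

Lemma transition_eq (W : Type) (F : M -> W) p q x : dm p x -> dm q x ->
  \forall y \near cd p x, (F \o pm p) y = ((F \o pm q) \o (cd q \o pm p)) y.
Proof.
move=> px qx; have := chart_near px (near_dom qx).
by apply: filterS => y dy /=; rewrite coordK.
Qed.

Lemma change_chart (W : normedModType R) (F : M -> W) p q x :
  dm p x -> dm q x -> differentiable (F \o pm q) (cd q x) ->
  hasdiff (F \o pm p) (cd p x)
    (fun v => 'd (F \o pm q) (cd q x) ('d (cd q \o pm p) (cd p x) v)).
Proof.
move=> px qx dF.
have h := differentiable_hasdiff (transition_diff px qx).
have {}dF : hasdiff (F \o pm q) ((cd q \o pm p) (cd p x)) ('d (F \o pm q) (cd q x)).
  by rewrite /= coordK//; exact: differentiable_hasdiff.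
have e : \forall y \near cd p x, (F \o pm q) ((cd q \o pm p) y) = (F \o pm p) y.
  by apply: filterS (transition_eq F px qx) => y ->.
exact: near_hasdiff e (hasdiff_comp h dF).
Qed.

Lemma mdiff_chart (W : normedModType R) (F : M -> W) p x : dm p x ->
  differentiable (F \o pm p) (cd p x) <-> mdiff F x.
Proof.
move=> px; split=> h; first exact: (change_chart _ px h).1.
exact: (change_chart px _ h).1.
Qed.

Lemma fdiff_chart (W : normedModType R) (F : M -> W) p x v : dm p x ->
  mdiff F x -> fdiff F x v = 'd (F \o pm p) (cd p x) (comp_in p x v).
Proof.
move=> px /(mdiff_chart _ px) h.
exact: (change_chart (chart_at_dom x) px h).2.
Qed.

Lemma mdiff_coord q x : dm q x -> mdiff (cd q) x.
Proof. exact: transition_diff. Qed.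

Lemma chart_id_diff q x v : dm q x -> 'd (cd q \o pm q) (cd q x) v = v.
Proof.
move=> qx; have e : \forall y \near cd q x, id y = (cd q \o pm q) y.
  by apply: filterS (chart_nearK qx) => y.
exact: (near_hasdiff e (hasdiff_id _)).2.
Qed.

Lemma comp_in_center x v : comp_in x x v = v.
Proof. exact: chart_id_diff. Qed.

Lemma mul_frame q x (c : 'rV[R]_n) : c *m frame q x =
  'd (cd x \o pm q) (cd q x) c.
Proof.
rewrite mulmx_sum_row diff_sum_delta; apply: eq_bigr => i _.
by rewrite rowK.
Qed.

Lemma transition_comp p q r x (c : 'rV[R]_n) : dm p x -> dm q x -> dm r x ->
  'd (cd r \o pm q) (cd q x) ('d (cd q \o pm p) (cd p x) c) =
  'd (cd r \o pm p) (cd p x) c.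
Proof.
move=> px qx rx; have h := transition_diff qx rx.
exact: esym ((change_chart (F := cd r) px qx h).2 c).
Qed.

Lemma comp_in_frame q r x (c : 'rV[R]_n) : dm q x -> dm r x ->
  comp_in r x (c *m frame q x) = 'd (cd r \o pm q) (cd q x) c.
Proof.
by move=> qx rx; rewrite mul_frame; exact: transition_comp (chart_at_dom x) rx.
Qed.

Lemma comp_inK q x (v : 'rV[R]_n) : dm q x -> comp_in q x v *m frame q x = v.
Proof.
move=> qx; rewrite mul_frame.
have := transition_comp v (chart_at_dom x) qx (chart_at_dom x).
by move=> ->; exact: chart_id_diff.
Qed.

Lemma frameK q x (c : 'rV[R]_n) : dm q x -> comp_in q x (c *m frame q x) = c.
Proof. by move=> qx; rewrite comp_in_frame//; exact: chart_id_diff. Qed.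

Lemma frame_unit q x : dm q x -> frame q x \in unitmx.
Proof.
move=> qx; rewrite -row_free_unit; apply/row_freeP.
(* Taking components in the chart at [q] undoes multiplication by the frame, so the matrix of this
   linear map is a right inverse. *)
exists (\matrix_i comp_in q x (delta_mx 0 i)); apply/row_matrixP => i.
rewrite row_mul row1 -[RHS](frameK _ qx) -rowE.
set v := row i _; rewrite mulmx_sum_row.
have -> : comp_in q x v = \sum_j v 0 j *: comp_in q x (delta_mx 0 j).
  exact: diff_sum_delta.
by apply: eq_bigr => j _; rewrite rowK.
Qed.

Lemma frame_center x : frame x x = 1%:M.
Proof.
apply/row_matrixP => i; rewrite row1 rowE mul_frame.
exact: comp_in_center.
Qed.

End Mdiff.

(** Continuity is asked for separately: coordinates take arbitrary values outside the chart domain,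
    so differentiability of [cd (f x) \o f] alone does not keep [f] near [f x]. *)
Definition mapdiff (R : realType) (m n : nat) (M : manifold R m)
    (N : manifold R n) (f : M -> N) (x : M) : Prop :=
  {for x, continuous f} /\ mdiff (cd (f x) \o f) x.

Section Maps.
Variables (R : realType) (m n : nat) (M : manifold R m) (N : manifold R n).
Implicit Types (f : M -> N).

Lemma fdiff_comp (W : normedModType R) (F : N -> W) f x : mapdiff f x ->
  mdiff F (f x) ->
  mdiff (F \o f) x /\ fdiff (F \o f) x =1 fdiff F (f x) \o tmap f x.
Proof.
move=> [cf df] dF.
have e : \forall y \near cd x x, (F \o pm (f x)) ((cd (f x) \o f \o pm x) y) =
    (F \o f \o pm x) y.
  have : \forall z \near x, dm (f x) (f z) by apply: cf; exact: near_dom.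
  move=> /(chart_near (chart_at_dom x)); apply: filterS => y h /=.
  by rewrite coordK.
apply: hasdiff_mdiff; apply: (near_hasdiff e).
apply: hasdiff_comp; first exact: mdiff_hasdiff.
by rewrite /= coord_center; exact: mdiff_hasdiff.
Qed.

Lemma tmap_chart f q x : dm q (f x) -> mapdiff f x ->
  mdiff (cd q \o f) x /\
  fdiff (cd q \o f) x =1 comp_in q (f x) \o tmap f x.
Proof. by move=> qx df; apply: fdiff_comp => //; exact: mdiff_coord. Qed.

Lemma smooth_mapdiff f x : smooth_map f -> mapdiff f x.
Proof.
move=> [cf sf]; split; first exact: cf.
have [+ _] := sf (f x) x 1; apply.
exact: (mem_chart_image (chart_at_dom x) (chart_at_dom (f x))).
Qed.

Lemma fdiff_linear (W : normedModType R) (F : M -> W) x : linear (fdiff F x).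
Proof. by move=> a u v; rewrite /fdiff linearP. Qed.

Lemma tmap_linear f x : linear (tmap f x).
Proof. exact: fdiff_linear. Qed.

End Maps.

Lemma tmap_comp (R : realType) (k m n : nat) (L : manifold R k) (M : manifold R m)
    (N : manifold R n) (i : L -> M) (f : M -> N) y v :
  mapdiff i y -> mapdiff f (i y) ->
  tmap (f \o i) y v = tmap f (i y) (tmap i y v).
Proof. by move=> di [_ df]; exact: (fdiff_comp di df).2. Qed.

Lemma mapdiff_comp (R : realType) (k m n : nat) (L : manifold R k) (M : manifold R m)
    (N : manifold R n) (i : L -> M) (f : M -> N) y :
  mapdiff i y -> mapdiff f (i y) -> mapdiff (f \o i) y.
Proof.
move=> di [cf df]; split; last exact: (fdiff_comp di df).1.
by apply: continuous_comp => //; case: di.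
Qed.

Lemma mapdiff_id (R : realType) (n : nat) (N : manifold R n) (x : N) :
  mapdiff (fun z : N => z) x.
Proof. by split; [move=> A; exact|exact: mdiff_coord]. Qed.

Lemma tmap_id (R : realType) (n : nat) (N : manifold R n) (x : N) v :
  tmap (fun z : N => z) x v = v.
Proof. exact: comp_in_center. Qed.

(** * Inner products given by matrices *)

Section Inner.
Variables (R : realType) (n : nat).
Implicit Types (G : 'M[R]_n) (u v w : 'rV[R]_n).

Lemma innerDl G u v w : inner G (u + v) w = inner G u w + inner G v w.
Proof. by rewrite /inner !mulmxDl mxE. Qed.
Lemma innerZl G a u w : inner G (a *: u) w = a * inner G u w.
Proof. by rewrite /inner -!scalemxAl mxE. Qed.
Lemma innerDr G u v w : inner G u (v + w) = inner G u v + inner G u w.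
Proof. by rewrite /inner linearD mulmxDr mxE. Qed.
Lemma innerZr G a u w : inner G u (a *: w) = a * inner G u w.
Proof. by rewrite /inner linearZ -scalemxAr mxE. Qed.
Lemma innerNl G u w : inner G (- u) w = - inner G u w.
Proof. by rewrite -scaleN1r innerZl mulN1r. Qed.
Lemma innerNr G u w : inner G u (- w) = - inner G u w.
Proof. by rewrite -scaleN1r innerZr mulN1r. Qed.
Lemma innerBl G u v w : inner G (u - v) w = inner G u w - inner G v w.
Proof. by rewrite innerDl innerNl. Qed.
Lemma inner0l G w : inner G 0 w = 0.
Proof. by rewrite /inner !mul0mx mxE. Qed.
Lemma inner0r G w : inner G w 0 = 0.
Proof. by rewrite /inner linear0 mulmx0 mxE. Qed.
Lemma innerDm G H u w : inner (G + H) u w = inner G u w + inner H u w.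
Proof. by rewrite /inner mulmxDr mulmxDl mxE. Qed.
Lemma innerZm G a u w : inner (a *: G) u w = a * inner G u w.
Proof. by rewrite /inner -scalemxAr -scalemxAl mxE. Qed.
Lemma innerBm G H u w : inner (G - H) u w = inner G u w - inner H u w.
Proof. by rewrite -scaleN1r innerDm innerZm mulN1r. Qed.
Lemma inner_suml G I (r : seq I) (u : I -> 'rV[R]_n) w :
  inner G (\sum_(i <- r) u i) w = \sum_(i <- r) inner G (u i) w.
Proof. by rewrite /inner !mulmx_suml summxE. Qed.
Lemma inner_trE G u v : inner G^T u v = inner G v u.
Proof.
by rewrite /inner -[in RHS](trmxK (v *m G *m u^T)) [RHS]mxE !trmx_mul trmxK mulmxA.
Qed.
Lemma inner_delta G i j : inner G (delta_mx 0 i) (delta_mx 0 j) = G i j.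
Proof. by rewrite /inner -rowE trmx_delta -colE !mxE. Qed.
End Inner.

Section InnerPos.
Variables (R : realType) (n : nat) (G : 'M[R]_n).
Hypothesis symG : forall u v, inner G u v = inner G v u.
Hypothesis posG : forall u, u != 0 -> 0 < inner G u u.

Lemma inner_nondeg (u v : 'rV[R]_n) :
  (forall w, inner G u w = inner G v w) -> u = v.
Proof.
move=> h; apply/eqP; rewrite -subr_eq0; apply/negPn/negP => /posG.
by rewrite {1}innerBl h subrr ltxx.
Qed.

Lemma inner_unit : G \in unitmx.
Proof.
rewrite -row_free_unit -kermx_eq0; apply/negPn/negP => /rowV0Pn[v /sub_kermxP h].
by move=> /posG; rewrite /inner h mul0mx mxE ltxx.
Qed.

Lemma inner_trmx : G^T = G.
Proof. by apply/matrixP => i j; rewrite mxE -!inner_delta symG. Qed.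
End InnerPos.

Section MetricComp.
Variables (R : realType) (n : nat) (N : manifold R n) (g : N -> 'M[R]_n).

Lemma metric_comp_center z : metric_comp g z z = g z.
Proof. by rewrite /metric_comp frame_center mul1mx trmx1 mulmx1. Qed.

Lemma metric_compE q z v w : dm q z ->
  inner (g z) v w = inner (metric_comp g q z) (comp_in q z v) (comp_in q z w).
Proof.
move=> qz; rewrite -{1}(comp_inK v qz) -{1}(comp_inK w qz) /inner /metric_comp.
by rewrite trmx_mul !mulmxA.
Qed.

End MetricComp.

(** * Bump functions and smooth fields *)

Section FlatFunction.
Variable R : realType.
Implicit Types (t : R) (k : nat).

(* The derivative of t^-k exp(-1/t) is a combination of functions of the same
   form, so that smoothness follows by induction from differentiability. *)
Definition flat k t : R := if 0 < t then t^-1 ^+ k * expR (- t^-1) else 0.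

(** One term of the exponential series bounds exp(1/t) below by t^-(k+2) / (k+2)!, which leaves a
    factor t^2. The square makes the difference quotient at 0 tend to 0. *)
Lemma flat_bound k t : `|flat k t| <= k.+2`!%:R * t ^+ 2.
Proof.
rewrite /flat; case: ifPn => [t0|_]; last first.
  by rewrite normr0 mulr_ge0// exprn_even_ge0.
have s0 : 0 < t^-1 by rewrite invr_gt0.
have := expR_ge1Dxn k.+1 (ltW s0); rewrite expRN => h.
have {}h : t^-1 ^+ k.+2 / k.+2`!%:R <= expR t^-1.
  by apply: le_trans h; rewrite lerDr.
rewrite ger0_norm; last by rewrite mulr_ge0// ?exprn_ge0 ?invr_ge0 ?expR_ge0// ltW.
rewrite ler_pdivrMr ?expR_gt0//.
apply: le_trans (_ : k.+2`!%:R * t ^+ 2 * (t^-1 ^+ k.+2 / k.+2`!%:R) <= _).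
  rewrite -addn2 exprD.
  have f0 : (k + 2)`!%:R != 0 :> R by rewrite pnatr_eq0 -lt0n fact_gt0.
  have t0' : t != 0 by rewrite gt_eqF.
  rewrite le_eqVlt; apply/orP; left; apply/eqP.
  move: (t^-1 ^+ k) ((k + 2)`!%:R : R) f0 => a b b0; field.
  by rewrite b0 t0'.
by rewrite ler_wpM2l// mulr_ge0// exprn_even_ge0.
Qed.

Lemma is_derive_flat k t :
  is_derive t 1 (flat k) (flat k.+2 t - k%:R * flat k.+1 t).
Proof.
have [t0|t0|<-] := ltgtP 0 t.
- have e : \near t, t^-1 ^+ k * expR (- t^-1) = flat k t.
    near=> s; rewrite /flat ifT//; near: s; exact: lt_nbhsr.
  apply: (near_eq_is_derive e); rewrite /flat t0.
  have t0' : t != 0 by rewrite gt_eqF.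
  have hV : is_derive t 1 (fun s : R => s^-1) (- t ^- 2 *: 1).
    by apply: is_deriveV => //; exact: is_derive_id.
  have hX := is_deriveX k hV.
  have hE : is_derive t 1 (expR \o (fun s : R => - s^-1)) (expR (- t^-1) * (- (- t ^- 2 *: 1))).
    by apply: is_derive1_comp; exact: is_deriveN.
  have E : (fun s : R => s^-1 ^+ k * expR (- s^-1)) =
      (fun s : R => s^-1) ^+ k * (expR \o (fun s : R => - s^-1)).
    by apply/funext => s; rewrite !fctE.
  rewrite E; apply: (is_derive_eq (is_deriveM hX hE)).
  rewrite !fctE -![_ *: _]/(_ * _) !mulr1 -exprVn.
  move: (expR _) => a; move: (t^-1) => b; case: k {e hX E} => [|k].
    by rewrite !expr0 !mul0r; ring.
  by rewrite /= !exprS; ring.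
- have e : \near t, (0 : R) = flat k t.
    near=> s; rewrite /flat ifF//; apply/negbTE; rewrite -leNgt ltW//; near: s.
    exact: lt_nbhsl.
  apply: (near_eq_is_derive e); rewrite /flat !ifN -?leNgt ?(ltW t0)//.
  by rewrite mulr0 subr0; exact: is_derive_cst.
have c : (fun h => h^-1 *: ((flat k \o shift 0) (h *: 1) - flat k 0)) @ 0^' --> (0 : R).
  apply/cvgr0Pnorm_le => e e0; near=> h.
  have h0 : h != 0 by near: h; exact: nbhs_dnbhs_neq.
  rewrite /= /flat ltxx subr0 -[_ *: _]/(_ * _) addr0 -/(flat k _) normrM normfV.
  rewrite [h *: 1]mulr1.
  apply: le_trans (ler_wpM2l _ (flat_bound _ _)) _; first by rewrite invr_ge0.
  rewrite -real_normK ?num_real// expr2 mulrCA mulKf ?normr_eq0//.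
  rewrite mulrC -ler_pdivlMr ?ltr0n ?fact_gt0//.
  near: h; apply: dnbhs0_le; rewrite divr_gt0// ltr0n fact_gt0//.
have z j : flat j 0 = 0 by rewrite /flat ltxx.
rewrite !z mulr0 subr0; split; last exact: cvg_lim c.
by apply/cvg_ex; exists 0.
Unshelve. all: by end_near.
Qed.

End FlatFunction.

Section EuclideanBump.
Variables (R : realType) (n : nat).

Lemma Cinf_flat_comp k j (Q : 'rV[R]_n -> R^o) : Cinf_on setT Q ->
  Ck_on k setT (fun y => flat j (Q y) : R^o).
Proof.
move=> hQ; have dQ y : differentiable Q y by have [+ _] := hQ 1; apply.
have hd i y := hasdiff_comp_real (differentiable_hasdiff (dQ y)) (is_derive_flat i (Q y)).
elim: k j => [|k ih] j /=.
  by move=> y _; exact: differentiable_continuous (hd j y).1.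
split=> [y _|v]; first exact: (hd j y).1.
apply: (@Ck_cong _ _ _ _ _ (fun y =>
  ((flat j.+2 (Q y) : R^o) + (- j%:R : R^o) *: (flat j.+1 (Q y) : R^o)) *: 'D_v Q y)).
- exact: openT.
- move=> y _; rewrite (hasdiff_derive v (hd j y)).
  rewrite (hasdiff_derive v (differentiable_hasdiff (dQ y))).
  by rewrite -mulNr.
apply: Ck_scale; [exact: openT| |exact: (hQ k.+1).2].
apply: CkD; [exact: openT|exact: ih|].
by apply: Ck_scale; [exact: openT|exact: Ck_cst|exact: ih].
Qed.

Lemma euclidean_bump (y0 : 'rV[R]_n) (e : R) : 0 < e ->
  exists b : 'rV[R]_n -> R^o, [/\ Cinf_on setT b, b y0 = 1 &
    forall y, b y != 0 -> `|y0 - y| <= e].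
Proof.
move=> e0.
(* [Q] is [e ^+ 2] minus the squared Euclidean distance to [y0]. The norm on row vectors is the
   maximum norm, which is not smooth in general but is dominated by the Euclidean one. Products are
   written as scalings so that [Ck_scale] applies. *)
pose Q (y : 'rV[R]_n) : R^o := e ^+ 2 + \sum_i (- 1 : R^o) *:
   ((y 0 i - y0 0 i : R^o) *: (y 0 i - y0 0 i : R^o)).
have QE y : Q y = e ^+ 2 - \sum_i (y 0 i - y0 0 i) ^+ 2.
  rewrite /Q; congr (_ + _); rewrite -sumrN; apply: eq_bigr => i _.
  by rewrite scaleN1r expr2.
have Ccoord k (i : 'I_n) : Ck_on k setT (fun y : 'rV[R]_n => y 0 i - y0 0 i : R^o).
  apply: CkD; [exact: openT| |exact: Ck_cst].
  apply: (Ck_coord 0 i openT (f := fun y => y)); case: k => [|k].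
    by move=> y _ A; exact.
  split=> [y _|v]; first exact: (hasdiff_id y).1.
  apply: (@Ck_cong _ _ _ _ _ (fun=> v)); [exact: openT| |exact: Ck_cst].
  by move=> y _; rewrite (hasdiff_derive v (hasdiff_id y)).
have CQ : Cinf_on setT Q.
  move=> k; apply: CkD; [exact: openT|exact: Ck_cst|].
  apply: (Ck_sum _ openT) => i; apply: Ck_scale; [exact: openT|exact: Ck_cst|].
  by apply: Ck_scale; [exact: openT| |]; exact: Ccoord.
pose c := flat 0 (Q y0).
have Qy0 : Q y0 = e ^+ 2.
  by rewrite QE big1 ?subr0// => i _; rewrite subrr expr0n.
have c0 : c != 0.
  by rewrite /c /flat Qy0 exprn_gt0// expr0 mul1r gt_eqF// expR_gt0.
exists (fun y => (c^-1 : R^o) *: (flat 0 (Q y) : R^o)); split.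
- by move=> k; apply: Ck_scale; [exact: openT|exact: Ck_cst|exact: Cinf_flat_comp].
- exact: mulVf.
move=> y; rewrite -[_ *: _]/(_ * _) mulf_eq0 negb_or => /andP[_].
rewrite /flat; case: ifPn => [|_]; last by rewrite eqxx.
rewrite QE subr_gt0 => h _.
rewrite /Num.norm /= mx_normrE; apply/bigmax_leP; split=> [|[i j] _]; first exact: ltW.
rewrite /= !mxE ord1 distrC -(@ler_pXn2r _ 2) ?nnegrE ?normr_ge0 ?(ltW e0)//.
rewrite real_normK ?num_real//; apply: le_trans _ (ltW h).
by rewrite (bigD1 j)//= lerDl sumr_ge0// => i' _; rewrite sqr_ge0.
Qed.

End EuclideanBump.

Section ManifoldBump.
Variables (R : realType) (n : nat) (M : manifold R n).

(** The closed set [K] serves to extend products with [b] by zero: they vanish on the open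
    complement of [K], in particular wherever the coordinates of the chart have no meaning. *)
Lemma manifold_bump (x : M) (U : set M) : open U -> U x ->
  exists (b : M -> R^o) (K : set M),
    [/\ closed K, K `<=` U `&` dm x, forall z, ~ K z -> b z = 0, b x = 1 &
        msmooth_on (dm x) b].
Proof.
move=> oU Ux.
have oS := open_chart_image (c := chart_at x) oU.
have Sx := mem_chart_image (chart_at_dom x) Ux.
have [e /= e0 eS] := (nbhs_ballP _ _).1 (open_nbhs_nbhs (conj oS Sx)).
(* Half the radius keeps the closed ball [C] inside the open ball of radius [e], hence inside the
   image of the chart. *)
have e20 : 0 < e / 2 by rewrite divr_gt0.
have [b [Cb b1 bsupp]] := euclidean_bump (cd x x) e20.
pose C := [set y | `|cd x x - y| <= e / 2].
have CS y : C y -> (cd x @` (dm x `&` U)) y.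
  move=> Cy; apply: eS; rewrite -ball_normE /=; apply: le_lt_trans Cy _.
  by rewrite ltr_pdivrMr// ltr_pMr// ltr1n.
have cC : compact C.
  have -> : C = closed_ball (cd x x) (e / 2) by rewrite closed_ballE.
  apply: bounded_closed_compact; last exact: closed_ball_closed.
  rewrite closed_ballE//; exists (`|cd x x| + e / 2); split; first exact: num_real.
  move=> t ht y Cy; apply: ltW; apply: le_lt_trans ht.
  by rewrite -[y](subKr (cd x x)); apply: le_trans (ler_normB _ _) _; rewrite lerD2l.
pose K := pm x @` C.
exists (fun z => if `[< dm x z >] then b (cd x z) else 0), K; split.
(* [K] is a continuous image of a compact ball, and compact sets are closed in a Hausdorff space. *)
- apply: compact_closed; first exact: manifold_hausdorff.
  apply: continuous_compact => //; apply: continuous_in_subspaceT => y /set_mem /CS.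
  move=> [z [dz _] <-]; apply: param_continuous; by exists z.
- by move=> _ [y /CS /chart_imageP[h1 h2 h3] <-].
- move=> z Kz; case: asboolP => // dz; apply/eqP/negPn/negP => /bsupp h.
  by apply: Kz; exists (cd x z) => //; rewrite coordK.
- by rewrite asboolT.
move=> p k.
have op := open_chart_image (c := chart_at p) (dom_open (chart_at x)).
apply: (@Ck_cong _ _ _ _ _ (fun y => b ((cd x \o pm p) y))) => //.
  by move=> y /chart_imageP[_ h _] /=; rewrite asboolT.
exact: Ck_comp op (fun _ _ => Logic.I) (chart_at_compat p x k) (Cb k).
Qed.

End ManifoldBump.

(** * Smooth functions and smooth fields on open sets *)

Lemma field_along_sub (R : realType) (m n : nat) (M : manifold R m)
    (N : manifold R n) (f : M -> N) (U U' : set M) (V : M -> 'rV[R]_n) :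
  U `<=` U' -> field_along_on f U' V -> field_along_on f U V.
Proof.
move=> UU' hV q p k; apply: Ck_sub (hV q p k).
by move=> _ [x [px [Ux qx]] <-]; exists x => //; split=> //; split=> //; exact: UU'.
Qed.

Section SmoothOn.
Variables (R : realType) (m : nat) (M : manifold R m).

Lemma msmooth_sub (W : normedModType R) (A A' : set M) (F : M -> W) :
  A `<=` A' -> msmooth_on A' F -> msmooth_on A F.
Proof.
move=> AA' h p k; apply: Ck_sub (h p k) => _ [x [px Ax] <-].
by exists x => //; split=> //; exact: AA'.
Qed.

Lemma msmooth_local (W : normedModType R) (A : set M) (F : M -> W) :
  (forall z, A z -> exists2 A', A' z & msmooth_on A' F) -> msmooth_on A F.
Proof.
move=> h p k; apply: Ck_local => _ [x [px Ax] <-].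
have [A' A'x hA'] := h x Ax; exists (cd p @` (dm p `&` A')); last exact: hA'.
exact: mem_chart_image.
Qed.

Variable A : set M.
Hypothesis oA : open A.

Let oS (p : M) : open (cd p @` (dm p `&` A)) := open_chart_image oA.

Lemma msmooth_cong (W : normedModType R) (F G : M -> W) :
  (forall z, A z -> F z = G z) -> msmooth_on A F -> msmooth_on A G.
Proof.
move=> FG h p k; apply: (Ck_cong (@oS p) _ (h p k)) => y /chart_imageP[_ Ay _].
exact: FG.
Qed.

Lemma msmooth_cst (W : normedModType R) (w : W) : msmooth_on A (fun=> w).
Proof. by move=> p k; exact: Ck_cst. Qed.

Lemma msmoothD (W : normedModType R) (F G : M -> W) :
  msmooth_on A F -> msmooth_on A G -> msmooth_on A (fun z => F z + G z).
Proof. by move=> hF hG p k; apply: CkD; [exact: oS|exact: hF|exact: hG]. Qed.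

Lemma msmooth_scale (W : normedModType R) (a : M -> R^o) (G : M -> W) :
  msmooth_on A a -> msmooth_on A G -> msmooth_on A (fun z => a z *: G z).
Proof. by move=> hF hG p k; apply: Ck_scale; [exact: oS|exact: hF|exact: hG]. Qed.

Lemma msmooth_mulmx a b c (F : M -> 'M[R]_(a, b)) (G : M -> 'M[R]_(b, c)) :
  msmooth_on A F -> msmooth_on A G -> msmooth_on A (fun z => F z *m G z).
Proof. by move=> hF hG p k; apply: Ck_mulmx; [exact: oS|exact: hF|exact: hG]. Qed.

Lemma msmooth_lin (V W : normedModType R) (L : {linear V -> W}) (F : M -> V) :
  continuous L -> msmooth_on A F -> msmooth_on A (fun z => L (F z)).
Proof. by move=> cL hF p k; apply: Ck_lin; [exact: oS|exact: cL|exact: hF]. Qed.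

Lemma msmooth_coord a b (F : M -> 'M[R]_(a, b)) i j :
  msmooth_on A F -> msmooth_on A (fun z => F z i j : R^o).
Proof. by move=> hF p k; apply: (Ck_coord i j (@oS p)); exact: hF. Qed.

Lemma msmooth_sum (W : normedModType R) (I : Type) (s : seq I) (F : I -> M -> W) :
  (forall i, msmooth_on A (F i)) -> msmooth_on A (fun z => \sum_(i <- s) F i z).
Proof.
move=> hF p k; apply: (Ck_sum _ (@oS p) (f := fun i => F i \o pm p)) => i.
exact: hF.
Qed.

Lemma msmooth_prod (I : Type) (s : seq I) (F : I -> M -> R) :
  (forall i, msmooth_on A (F i : M -> R^o)) ->
  msmooth_on A (fun z => \prod_(i <- s) F i z : R^o).
Proof.
move=> hF; elim: s => [|i s ih].
  by apply: msmooth_cong (msmooth_cst (1 : R^o)) => z _; rewrite big_nil.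
by apply: msmooth_cong (msmooth_scale (hF i) ih) => z _; rewrite big_cons.
Qed.

Lemma msmooth_det d (F : M -> 'M[R]_d) :
  (forall i j, msmooth_on A (fun z => F z i j : R^o)) ->
  msmooth_on A (fun z => \det (F z) : R^o).
Proof.
move=> hF.
apply: (@msmooth_sum R^o _ (index_enum {perm 'I_d})
  (fun s z => ((-1) ^+ s : R^o) *: (\prod_i F z i (s i) : R^o))).
move=> s; apply: (msmooth_scale (a := fun=> (-1) ^+ s)); first exact: msmooth_cst.
by apply: msmooth_prod => i; exact: hF.
Qed.

(** The adjugate inverts a Gram matrix up to its determinant without any division, so its smoothness
    is that of a polynomial in the entries. *)
Lemma msmooth_adj d (F : M -> 'M[R]_d) i j :
  (forall i j, msmooth_on A (fun z => F z i j : R^o)) ->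
  msmooth_on A (fun z => (\adj (F z)) i j : R^o).
Proof.
move=> hF; have E : forall z, A z -> (-1 : R^o) ^+ (j + i) *:
    (\det (row' j (col' i (F z))) : R^o) = (\adj (F z)) i j.
  by move=> z _; rewrite mxE.
apply: (msmooth_cong E); apply: msmooth_scale; first exact: msmooth_cst.
apply: msmooth_det => a b; apply: msmooth_cong (hF (lift j a) (lift i b)).
by move=> z _; rewrite !mxE.
Qed.

End SmoothOn.

Section SmoothFields.
Variables (R : realType) (m n : nat) (M : manifold R m) (N : manifold R n).
Variables (f : M -> N).
Hypothesis sf : smooth_map f.

Lemma open_fdom (U : set M) q : open U -> open (U `&` f @^-1` dm q).
Proof.
move=> oU; apply: openI => //.
by have [cf _] := sf; apply: open_comp; [move=> x _; exact: cf|exact: dom_open].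
Qed.

Lemma field_alongD U (V W : M -> 'rV[R]_n) : open U ->
  field_along_on f U V -> field_along_on f U W ->
  field_along_on f U (fun x => V x + W x).
Proof.
move=> oU hV hW q; apply: msmooth_cong (msmoothD _ (hV q) (hW q)).
- exact: open_fdom.
- by move=> z _; rewrite /comp_in /fdiff linearD.
- exact: open_fdom.
Qed.

Lemma field_along_scale U (a : M -> R^o) (V : M -> 'rV[R]_n) : open U ->
  msmooth_on U a -> field_along_on f U V ->
  field_along_on f U (fun x => a x *: V x).
Proof.
move=> oU ha hV q; have h := msmooth_sub (@subIsetl _ U (f @^-1` dm q)) ha.
apply: msmooth_cong (msmooth_scale _ h (hV q)).
- exact: open_fdom.
- by move=> z _; rewrite /comp_in /fdiff linearZ.
- exact: open_fdom.
Qed.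

Lemma field_along0 U : open U -> field_along_on f U (fun=> 0).
Proof.
move=> oU q; apply: msmooth_cong (msmooth_cst _ (0 : 'rV[R]_n)).
- exact: open_fdom.
- by move=> z _; rewrite /comp_in /fdiff linear0.
Qed.

Lemma field_along_sum U (I : Type) (s : seq I) (V : I -> M -> 'rV[R]_n) :
  open U -> (forall i, field_along_on f U (V i)) ->
  field_along_on f U (fun x => \sum_(i <- s) V i x).
Proof.
move=> oU h; elim: s => [|i s ih].
  under [fun x => _]funext do rewrite big_nil; exact: field_along0.
by under [fun x => _]funext do rewrite big_cons; exact: field_alongD.
Qed.

Lemma push_smooth U (E : M -> 'rV[R]_m) : open U ->
  vector_field_on U E -> field_along_on f U (push f E).
Proof.
move=> oU hE q p k.
have oS := open_chart_image (c := chart_at p) (open_fdom q oU).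
pose fh := cd q \o f \o pm p.
(* The components of the pushed field are sums of components of [E] times partial derivatives of
   [f], so order [k] asks for order [k.+1] of [f]. *)
have hf v : Ck_on k (cd p @` (dm p `&` (U `&` f @^-1` dm q))) ('D_v fh).
  apply: Ck_sub ((sf.2 q p k.+1).2 v) => _ [z [pz [_ qz]] <-].
  by exists z.
have hc (j : 'I_m) : Ck_on k (cd p @` (dm p `&` (U `&` f @^-1` dm q)))
    (fun y => comp_in p (pm p y) (E (pm p y)) 0 j : R^o).
  apply: (Ck_coord 0 j oS (f := fun y => comp_in p (pm p y) (E (pm p y)))).
  apply: Ck_sub (hE p p k) => _ [z [pz [Uz qz]] <-].
  by exists z => //.
apply: (Ck_cong oS _ (Ck_sum (index_enum 'I_m) oS
  (fun j => Ck_scale oS (hc j) (hf (delta_mx 0 j))))) => y /chart_imageP[pz [Uz qz] yE] /=.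
have df := smooth_mapdiff (pm p y) sf.
have [h1 h2] := tmap_chart qz df.
rewrite /push -[RHS]h2 (fdiff_chart _ pz h1) diff_sum_delta.
apply: eq_bigr => j _; congr (_ *: _).
have := hasdiff_derive (delta_mx 0 j) (differentiable_hasdiff ((mdiff_chart _ pz).2 h1)).
by rewrite yE.
Qed.

Lemma msmooth_pullback (W : normedModType R) (A : set N) (F : N -> W) : open A ->
  msmooth_on A F -> msmooth_on (f @^-1` A) (F \o f).
Proof.
move=> oA hF; apply: msmooth_local => z Az.
have oV : open (f @^-1` A `&` f @^-1` dm (f z)).
  apply: open_fdom; have [cf _] := sf.
  by apply: open_comp => // x _; exact: cf.
exists (f @^-1` A `&` f @^-1` dm (f z)); first by split=> //; exact: chart_at_dom.
move=> p k; have oS := open_chart_image (c := chart_at p) oV.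
pose q := f z; pose fh := cd q \o f \o pm p.
apply: (@Ck_cong _ _ _ _ _ (fun y => (F \o pm q) (fh y))) => //.
  by move=> y /chart_imageP[_ [_ qy] _]; rewrite /fh /= coordK.
apply: (Ck_comp oS _ _ (hF q k)).
  move=> y /chart_imageP[_ [Ay qy] _]; exact: mem_chart_image.
by apply: Ck_sub (sf.2 q p k) => _ [w [pw [_ qw]] <-]; exists w.
Qed.

Lemma inner_smooth (g : N -> 'M[R]_n) U V W : open U -> riemannian_on setT g ->
  field_along_on f U V -> field_along_on f U W ->
  msmooth_on U (fun z => inner (g (f z)) (V z) (W z) : R^o).
Proof.
move=> oU [_ _ hg] hV hW; apply: msmooth_local => z Uz; set q := f z.
exists (U `&` f @^-1` dm q); first by split=> //; exact: chart_at_dom.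
have oA := open_fdom q oU.
have hG : msmooth_on (U `&` f @^-1` dm q) (metric_comp g q \o f).
  have := msmooth_pullback (dom_open (chart_at q)) (msmooth_sub _ (hg q)).
  move=> h; apply: (msmooth_sub _ (h _)); first by move=> ? [].
  by move=> ?; split.
have hT := msmooth_lin oA (@linear_mx_continuous _ _ _ _ (@trmx R 1 n)) (hW q).
have := msmooth_coord oA 0 0 (msmooth_mulmx oA (msmooth_mulmx oA (hV q) hG) hT).
by apply: msmooth_cong => // w [_ qw]; rewrite (metric_compE _ _ _ qw).
Qed.

End SmoothFields.

(** * Extension of tangent vectors to global fields *)

Section Extension.
Variables (R : realType) (m : nat) (M : manifold R m).

Lemma smooth_id : smooth_map (fun x : M => x).
Proof.
split=> [x A|q]; first exact.
by move=> p; exact: chart_at_compat.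
Qed.

(** Two kinds of open sets cover the manifold: those inside [U] and the chart, where the product is
    smooth, and the complement of [K], where it is 0. The factor [b] is exposed because
    multiplication by a scalar keeps the field in any distribution that contains [E] on [U]. *)
Lemma field_globalize (U : set M) (E : M -> 'rV[R]_m) x : open U -> U x ->
  vector_field_on U E -> exists b : M -> R^o, b x = 1 /\
    vector_field (fun z => b z *: E z) /\ (forall z, ~ U z -> b z = 0).
Proof.
move=> oU Ux hE; have [b [K [cK KU bK b1 sb]]] := manifold_bump oU Ux.
exists b; split=> //; split; last by move=> z Uz; apply: bK => /KU[].
move=> q; apply: msmooth_local => z [_ qz].
have [Kz|Kz] := pselect (K z); last first.
  exists (~` K) => //; apply: (msmooth_cong _ _ (msmooth_cst _ (0 : 'rV[R]_m))).
    exact: closed_openC.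
  by move=> w /bK ->; rewrite scale0r /comp_in /fdiff linear0.
have [Uz dz] := KU _ Kz.
have oUd : open (U `&` dm x) by apply: openI => //; exact: dom_open.
exists ((U `&` dm x) `&` dm q) => //.
apply: (field_along_scale smooth_id oUd (msmooth_sub (@subIsetr _ _ _) sb)
  (field_along_sub (@subIsetl _ _ _) hE)).
Qed.

Lemma vector_field_extension (x : M) (v : 'rV[R]_m) :
  exists2 X : M -> 'rV[R]_m, vector_field X & X x = v.
Proof.
(* The field with constant components [v] in the chart at [x]; its values outside that chart are
   meaningless and the cut-off discards them. *)
pose E z := v *m frame x z.
have hE : vector_field_on (dm x) E.
  move=> q p k.
  have oq : open (dm x `&` dm q) by apply: openI; exact: dom_open.
  have oS := open_chart_image (c := chart_at p) oq.
  have h1 : Ck_on k (cd p @` (dm p `&` (dm x `&` dm q))) (cd x \o pm p).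
    by apply: Ck_sub (chart_at_compat p x k) => _ [z [pz [xz qz]] <-]; exists z.
  apply: (Ck_cong oS _ (Ck_comp oS _ h1 ((chart_at_compat x q k.+1).2 v))).
    move=> y /chart_imageP[pz [xz qz] yE] /=; rewrite /E comp_in_frame//.
    exact: hasdiff_derive (differentiable_hasdiff (transition_diff xz qz)).
  by move=> y /chart_imageP[pz [xz qz] yE]; exact: mem_chart_image.
have [b [b1 [hb _]]] := field_globalize (dom_open _) (chart_at_dom x) hE.
exists (fun z => b z *: E z) => //.
by rewrite b1 scale1r /E frame_center mulmx1.
Qed.

End Extension.

(** * The Levi-Civita derivative *)

Section Christoffel.
Variables (R : realType) (n : nat) (N : manifold R n) (g : N -> 'M[R]_n).

(** Only the chart centred at [z] is used: there the frame is the identity, the Gram matrix is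
    [g z], and a tangent vector at [z] coincides with its components. *)
Definition christoffel_form (z : N) (a b : 'rV[R]_n) : 'rV[R]_n :=
  \row_k \sum_i \sum_j christoffel g z (cd z z) i j k * a 0 i * b 0 j.

Definition metric_diff (z : N) (u : 'rV[R]_n) : 'M[R]_n :=
  fdiff (metric_comp g z) z u.

Lemma covE m (M : manifold R m) (f : M -> N) u V x :
  cov g f u V x = fdiff (fun x' => comp_in (f x) (f x') (V x')) x u +
    christoffel_form (f x) (tmap f x u) (V x).
Proof. by []. Qed.

Variable z : N.
Hypothesis dg : mdiff (metric_comp g z) z.

Lemma christoffelE i j k : christoffel g z (cd z z) i j k =
  2^-1 * \sum_l invmx (g z) k l * (metric_diff z (delta_mx 0 i) j l +
    metric_diff z (delta_mx 0 j) i l - metric_diff z (delta_mx 0 l) i j).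
Proof.
rewrite /christoffel; congr (_ * _); apply: eq_bigr => l _.
rewrite coord_center metric_comp_center; congr (_ * _).
have h a b c : 'D_(delta_mx 0 a) (fun y => metric_comp g z (pm z y) b c : R^o)
    (cd z z) = metric_diff z (delta_mx 0 a) b c.
  exact: (hasdiff_derive _ (hasdiff_coord b c (mdiff_hasdiff dg))).
by rewrite !h.
Qed.

Hypothesis symg : forall u v, inner (g z) u v = inner (g z) v u.
Hypothesis posg : forall u, u != 0 -> 0 < inner (g z) u u.

Lemma metric_diff_linear : linear (metric_diff z).
Proof. exact: fdiff_linear. Qed.

Lemma metric_diff_sum u : metric_diff z u =
  \sum_i u 0 i *: metric_diff z (delta_mx 0 i).
Proof. exact: diff_sum_delta. Qed.

Lemma bilinear_sum (T : 'rV[R]_n -> 'rV[R]_n -> R) :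
  (forall b, linear (T^~ b : _ -> R^o)) -> (forall a, linear (T a : _ -> R^o)) ->
  forall a b, T a b = \sum_i \sum_j a 0 i * b 0 j * T (delta_mx 0 i) (delta_mx 0 j).
Proof.
move=> l1 l2 a b.
pose t1 : {linear 'rV[R]_n -> R^o} := HB.pack (T^~ b : _ -> R^o)
  (GRing.isLinear.Build _ _ _ _ _ (l1 b)).
rewrite -[LHS]/(t1 a) [a in LHS]row_sum_delta linear_sum; apply: eq_bigr => i _.
rewrite linearZ /=.
pose t2 : {linear 'rV[R]_n -> R^o} := HB.pack (T (delta_mx 0 i) : _ -> R^o)
  (GRing.isLinear.Build _ _ _ _ _ (l2 (delta_mx 0 i))).
rewrite -[T _ b]/(t2 b) [b in LHS]row_sum_delta linear_sum scaler_sumr.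
by apply: eq_bigr => j _; rewrite linearZ /= scalerA.
Qed.

Lemma christoffel_form_sum a b : christoffel_form z a b =
  \sum_i \sum_j (a 0 i * b 0 j) *: \row_k christoffel g z (cd z z) i j k.
Proof.
apply/rowP => k; rewrite mxE summxE; apply: eq_bigr => i _.
rewrite summxE; apply: eq_bigr => j _; rewrite !mxE; ring.
Qed.

Lemma christoffel_row i j : (\row_k christoffel g z (cd z z) i j k) *m g z =
  2^-1 *: \row_l (metric_diff z (delta_mx 0 i) j l +
    metric_diff z (delta_mx 0 j) i l - metric_diff z (delta_mx 0 l) i j).
Proof.
set L := (X in _ = 2^-1 *: X).
have -> : \row_k christoffel g z (cd z z) i j k = 2^-1 *: (L *m (invmx (g z))^T).
  apply/rowP => k; rewrite !mxE christoffelE; congr (_ * _).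
  by apply: eq_bigr => l _; rewrite !mxE mulrC.
rewrite -scalemxAl -mulmxA trmx_inv inner_trmx// mulVmx ?mulmx1//.
exact: inner_unit.
Qed.

(* The Koszul formula: the Christoffel form is determined by lowering its index. *)
Lemma inner_christoffel a b c : inner (g z) (christoffel_form z a b) c =
  2^-1 * (inner (metric_diff z a) b c + inner (metric_diff z b) a c
          - inner (metric_diff z c) a b).
Proof.
rewrite [RHS](bilinear_sum (T := fun a b => 2^-1 *
    (inner (metric_diff z a) b c + inner (metric_diff z b) a c
     - inner (metric_diff z c) a b))); first last.
- move=> a' k u v; rewrite metric_diff_linear.
  rewrite !(innerDm, innerZm, innerDl, innerZl, innerDr, innerZr).
  rewrite -[k *: _]/(k * _); ring.
- move=> a' k u v; rewrite metric_diff_linear.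
  rewrite !(innerDm, innerZm, innerDl, innerZl, innerDr, innerZr).
  rewrite -[k *: _]/(k * _); ring.
rewrite christoffel_form_sum inner_suml; apply: eq_bigr => i _.
rewrite inner_suml; apply: eq_bigr => j _; rewrite innerZl; congr (_ * _).
rewrite /inner christoffel_row -scalemxAl mxE; congr (_ * _).
rewrite mxE (metric_diff_sum c) !mulmx_sumr !mulmx_suml.
rewrite summxE -!rowE.
rewrite [X in X + _ - _]mxE [X in _ + X - _]mxE -big_split -sumrB /=.
apply: eq_bigr => l _.
rewrite -scalemxAr -scalemxAl trmx_delta -rowE -colE !mxE; ring.
Qed.

End Christoffel.

Lemma metric_diff_sym (R : realType) (n : nat) (N : manifold R n)
    (g : N -> 'M[R]_n) (z : N) : mdiff (metric_comp g z) z ->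
  (forall x u v, inner (g x) u v = inner (g x) v u) ->
  forall a b c, inner (metric_diff g z a) b c = inner (metric_diff g z a) c b.
Proof.
move=> dg symg a b c.
have E : metric_comp g z = fun x => trmx (metric_comp g z x).
  apply/funext => x; rewrite /metric_comp !trmx_mul trmxK mulmxA.
  by rewrite (inner_trmx (symg x)).
have [_ h] := fdiff_lin (@linear_mx_continuous _ _ _ _ (@trmx R n n)) dg.
have dE : metric_diff g z a = (metric_diff g z a)^T.
  by rewrite -[RHS](h a) /metric_diff -E.
by rewrite {1}dE inner_trE.
Qed.

(** * Conformal change of the metric *)

Section Conformal.
Variables (R : realType) (n : nat) (N : manifold R n) (g : N -> 'M[R]_n).
Variables (z : N) (phi : N -> R) (omega : 'cV[R]_n) (b0 : 'rV[R]_n).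
Hypothesis dg : mdiff (metric_comp g z) z.
Hypothesis dphi : mdiff (phi : N -> R^o) z.
Hypothesis symg : forall u v, inner (g z) u v = inner (g z) v u.
Hypothesis posg : forall u, u != 0 -> 0 < inner (g z) u u.
Hypothesis omegaE : forall v, form_app omega v = fdiff (phi : N -> R^o) z v.
Hypothesis b0E : forall v, inner (g z) v b0 = form_app omega v.

Let gt x := expR (- phi x) *: g x.

Lemma fdiff_expN : mdiff (fun x => expR (- phi x) : R^o) z /\
  fdiff (fun x => expR (- phi x) : R^o) z =1
    fun u => - expR (- phi z) * fdiff (phi : N -> R^o) z u.
Proof.
have h := hasdiffB (hasdiff_cst (0 : R^o) _) (mdiff_hasdiff dphi).
have := hasdiff_comp_real h (is_derive_expR _).
rewrite /= sub0r coord_center => {}h.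
have E : (fun y => expR (0 - phi (pm z y)) : R^o) =
    (fun x => expR (- phi x) : R^o) \o pm z.
  by apply/funext => y /=; rewrite sub0r.
apply: hasdiff_mdiff; rewrite -E; apply: hasdiff_eq h _ => u.
by rewrite sub0r mulrN mulNr.
Qed.

Lemma conformal_metric_diff : mdiff (metric_comp gt z) z /\
  metric_diff gt z =1
    fun u => expR (- phi z) *: (metric_diff g z u - form_app omega u *: g z).
Proof.
have E : metric_comp gt z = fun x => (expR (- phi x) : R^o) *: metric_comp g z x.
  by apply/funext => x; rewrite /metric_comp /gt -scalemxAr -scalemxAl.
have [d1 d2] := fdiff_expN.
have [h1 h2] := fdiff_scale d1 dg.
rewrite /metric_diff E; split=> // u; rewrite h2 d2 metric_comp_center omegaE.
rewrite scalerBr scalerA addrC; congr (_ + _).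
by rewrite mulNr scaleNr.
Qed.

(* The Weyl connection of the l.c.K. structure. *)
Lemma conformal_christoffel a b : christoffel_form gt z a b =
  christoffel_form g z a b - 2^-1 *:
   (form_app omega a *: b + form_app omega b *: a - inner (g z) a b *: b0).
Proof.
have [h1 h2] := conformal_metric_diff.
have e0 : 0 < expR (- phi z) := expR_gt0 _.
have symt u v : inner (gt z) u v = inner (gt z) v u by rewrite !innerZm symg.
have post u : u != 0 -> 0 < inner (gt z) u u.
  by move=> /posg h; rewrite innerZm mulr_gt0.
(* Both sides are compared after lowering the index with [g]. The factor exp(-phi) then turns the
   left side into a product for [gt], to which the Koszul formula of [gt] applies. *)
apply: (inner_nondeg posg) => c.
apply: (mulfI (lt0r_neq0 e0)); rewrite -[LHS]innerZm.
rewrite (inner_christoffel h1 symt post) !h2.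
rewrite innerBl innerZl innerBl innerDl !innerZl (inner_christoffel dg symg posg).
rewrite !(innerZm, innerBm) (symg b0 c) b0E.
ring.
Qed.

End Conformal.

(** * Covariant derivatives of fields along a map *)

Section CovCalculus.
Variables (R : realType) (m n : nat) (M : manifold R m) (N : manifold R n).
Variables (f : M -> N) (x : M).
Hypothesis df : mapdiff f x.

Definition field_mdiff (V : M -> 'rV[R]_n) : Prop :=
  mdiff (fun x' => comp_in (f x) (f x') (V x')) x.

Lemma near_fdom : \forall z \near x, dm (f x) (f z).
Proof. by case: df => cf _; apply: cf; exact: near_dom. Qed.

Lemma field_mdiffB V W : field_mdiff V -> field_mdiff W ->
  field_mdiff (fun z => V z - W z).
Proof.
move=> dV dW; rewrite /field_mdiff.
have -> : (fun z => comp_in (f x) (f z) (V z - W z)) =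
    fun z => comp_in (f x) (f z) (V z) - comp_in (f x) (f z) (W z).
  by apply/funext => z; rewrite /comp_in /fdiff linearB.
exact: (fdiffB dV dW).1.
Qed.

Lemma covB g u V W : field_mdiff V -> field_mdiff W ->
  cov g f u (fun z => V z - W z) x = cov g f u V x - cov g f u W x.
Proof.
move=> dV dW; rewrite !covE.
have E : (fun z => comp_in (f x) (f z) (V z - W z)) =
    fun z => comp_in (f x) (f z) (V z) - comp_in (f x) (f z) (W z).
  by apply/funext => z; rewrite /comp_in /fdiff linearB.
have [_ h] := fdiffB dV dW.
rewrite E h opprD addrACA; congr (_ + _).
apply/rowP => k; rewrite !mxE -sumrB; apply: eq_bigr => i _.
by rewrite -sumrB; apply: eq_bigr => j _; rewrite !mxE mulrBr.
Qed.

Section Metric.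
Variables (g : N -> 'M[R]_n).
Hypothesis dg : mdiff (metric_comp g (f x)) (f x).
Hypothesis symg : forall z u v, inner (g z) u v = inner (g z) v u.
Hypothesis posg : forall u, u != 0 -> 0 < inner (g (f x)) u u.

(** Compatibility with the metric. The Leibniz rule in coordinates leaves the derivative of the Gram
    matrix; by the Koszul formula the two Christoffel terms add up to it, their other four
    contributions cancelling by symmetry. *)
Lemma cov_metric V W u : field_mdiff V -> field_mdiff W ->
  fdiff (fun z => inner (g (f z)) (V z) (W z) : R^o) x u =
  inner (g (f x)) (cov g f u V x) (W x) + inner (g (f x)) (V x) (cov g f u W x).
Proof.
move=> dV dW.
have e : \forall z \near x, inner (g (f z)) (V z) (W z) =
   coord_lin 0 0 (comp_in (f x) (f z) (V z) *m metric_comp g (f x) (f z) *m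
     trmx (comp_in (f x) (f z) (W z))).
  by apply: filterS near_fdom => z hz; rewrite (metric_compE _ _ _ hz).
have [dG dGE] := fdiff_comp df dg.
have [d1 d1E] := fdiff_mulmx dV dG.
have [d2 d2E] := fdiff_lin (@linear_mx_continuous _ _ _ _ (@trmx R 1 n)) dW.
have [d3 d3E] := fdiff_mulmx d1 d2.
have [d4 d4E] := fdiff_lin (@coord_lin_continuous _ _ _ 0 0) d3.
have [_ ->] := near_fdiff e d4.
rewrite d4E /= d3E d1E d2E /= dGE /= !comp_in_center metric_comp_center.
rewrite [LHS](_ : _ = inner (g (f x))
    (fdiff (fun z => comp_in (f x) (f z) (V z)) x u) (W x) +
    inner (metric_diff g (f x) (tmap f x u)) (V x) (W x) +
    inner (g (f x)) (V x) (fdiff (fun z => comp_in (f x) (f z) (W z)) x u)); last first.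
  by rewrite /inner /coord_lin mulmxDl mxE; congr (_ + _); rewrite mxE.
rewrite !covE innerDl innerDr (symg (f x) (V x) (christoffel_form _ _ _ _)).
rewrite !(inner_christoffel dg (symg (f x)) posg).
rewrite (metric_diff_sym dg symg (tmap f x u) (W x)).
rewrite (metric_diff_sym dg symg (V x)) (metric_diff_sym dg symg (W x)).
move: (inner (g (f x)) (fdiff _ x u) (W x)) => a1.
move: (inner (g (f x)) (V x) (fdiff _ x u)) => a2.
move: (inner (metric_diff _ _ (tmap f x u)) _ _) => a3.
move: (inner (metric_diff _ _ (V x)) _ _) => a4.
move: (inner (metric_diff _ _ (W x)) _ _) => a5.
lra.
Qed.

End Metric.

End CovCalculus.

(** * The derivative of J on an l.c.K. manifold *)

Section EndoComp.
Variables (R : realType) (n : nat) (N : manifold R n) (J : N -> 'M[R]_n).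

Lemma endo_compE q z v : dm q z ->
  comp_in q z (v *m J z) = comp_in q z v *m endo_comp J q z.
Proof.
move=> qz; have := frameK (comp_in q z v *m endo_comp J q z) qz => <-.
congr (comp_in q z _); rewrite /endo_comp !mulmxA mulmxKV ?frame_unit//.
by rewrite comp_inK.
Qed.

Lemma endo_comp_center z : endo_comp J z z = J z.
Proof. by rewrite /endo_comp frame_center invmx1 mul1mx mulmx1. Qed.

End EndoComp.

Lemma field_along_mdiff (R : realType) (m n : nat) (M : manifold R m)
    (N : manifold R n) (f : M -> N) (U : set M) (V : M -> 'rV[R]_n) x :
  U x -> field_along_on f U V -> field_mdiff f x V.
Proof.
move=> Ux hV; have [+ _] := hV (f x) x 1; apply.
exact: (mem_chart_image (chart_at_dom x) (conj Ux (chart_at_dom (f x)))).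
Qed.

Section CovJ.
Variables (R : realType) (m n : nat) (M : manifold R m) (N : manifold R n).
Variables (f : M -> N) (x : M) (J g : N -> 'M[R]_n).
Hypothesis df : mapdiff f x.
Hypothesis dJ : mdiff (endo_comp J (f x)) (f x).

Lemma cov_endo V u : field_mdiff f x V ->
  field_mdiff f x (fun z => V z *m J (f z)) /\
  cov g f u (fun z => V z *m J (f z)) x =
    fdiff (fun z => comp_in (f x) (f z) (V z)) x u *m J (f x) +
    V x *m fdiff (endo_comp J (f x)) (f x) (tmap f x u) +
    christoffel_form g (f x) (tmap f x u) (V x *m J (f x)).
Proof.
move=> dV.
have e : \forall z \near x, comp_in (f x) (f z) (V z *m J (f z)) =
    comp_in (f x) (f z) (V z) *m endo_comp J (f x) (f z).
  by apply: filterS (near_fdom df) => z hz; rewrite endo_compE.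
have [dJf dJfE] := fdiff_comp df dJ.
have [h1 h1E] := fdiff_mulmx dV dJf.
have [h2 h2E] := near_fdiff e h1.
split=> //; rewrite covE h2E h1E dJfE /= comp_in_center endo_comp_center.
by [].
Qed.

End CovJ.

Section LeeJ.
Variables (R : realType) (n : nat) (N : manifold R n) (J g : N -> 'M[R]_n).

(** Parallelism is stated for fields; extending [u] and [v] and cancelling the derivative of the
    second field makes it pointwise. The left side does not depend on [gt], which allows the
    comparison with the Christoffel form of another metric. *)
Lemma kaehler_diffJ (U : set N) gt x u v : U x -> kaehler_on U J gt ->
  mdiff (endo_comp J x) x ->
  v *m fdiff (endo_comp J x) x u =
    christoffel_form gt x u v *m J x - christoffel_form gt x u (v *m J x).
Proof.
move=> Ux [_ K] dJ.
have [X hX Xx] := vector_field_extension x u.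
have [Y hY Yx] := vector_field_extension x v.
have dY : field_mdiff (fun z : N => z) x Y by exact: field_along_mdiff hY.
have [_] := cov_endo gt (mapdiff_id x) dJ u dY.
have := K X Y; rewrite -{1}Xx => -> //; last 2 first.
- exact: field_along_sub (@subsetT _ _) hX.
- exact: field_along_sub (@subsetT _ _) hY.
rewrite Xx covE !tmap_id Yx mulmxDl => E.
apply: (addrI (fdiff (fun z => comp_in x z (Y z)) x u *m J x)).
apply: (addIr (christoffel_form gt x u (v *m J x))).
by rewrite -E -[RHS]addrA subrK.
Qed.

Variables (omega : N -> 'cV[R]_n) (B : N -> 'rV[R]_n).
Hypothesis lcg : lck J g.
Hypothesis lee : lee_form J g omega.
Hypothesis leeB : lee_vector g omega B.

Lemma lck_metric : [/\ forall z u v, inner (g z) u v = inner (g z) v u,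
   forall z u, u != 0 -> 0 < inner (g z) u u,
   forall z, mdiff (metric_comp g z) z &
   forall z, mdiff (endo_comp J z) z].
Proof.
have [[[h1 h2 h3] h4 h5 h6] _] := lcg; split=> [z u v|z u|z|z]; [exact: h1|exact: h2| |].
- have [+ _] := h3 z z 1; apply.
  by apply: mem_chart_image => //; split.
- have [+ _] := h4 z z 1; apply.
  by apply: mem_chart_image => //; split.
Qed.

(* The value of (nabla_u J) v on an l.c.K. manifold. *)
Definition lee_correction x (u v : 'rV[R]_n) : 'rV[R]_n :=
  2^-1 *: (anti_lee_form J omega x v *: u - form_app (omega x) v *: (u *m J x)
    - inner (g x) u v *: anti_lee_vector J B x - inner (g x) u (v *m J x) *: B x).

(** The correction is the commutator of J with the conformal change of the Christoffel form. The two
    terms in omega(u) cancel, and the remaining term in JB is rewritten with A = - JB. *)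
Lemma lck_diffJ x u v : v *m fdiff (endo_comp J x) x u =
  christoffel_form g x u v *m J x - christoffel_form g x u (v *m J x)
   + lee_correction x u v.
Proof.
have [sg pg dg dJ] := lck_metric.
have [U [phi [Ux [oU sphi _ K] omegaE]]] := lee x.
rewrite (kaehler_diffJ u v Ux K (dJ x)).
have dphi : mdiff (phi : N -> R^o) x.
  have [+ _] := sphi x 1; apply; exact: (mem_chart_image (chart_at_dom x) Ux).
have cc := conformal_christoffel (dg x) dphi (sg x) (pg x) (omegaE x Ux) (leeB x).
rewrite !cc /lee_correction /anti_lee_form /anti_lee_vector.
rewrite mulmxBl -scalemxAl [in LHS]mulmxBl mulmxDl -!scalemxAl.
have aux (P Q a b : 'rV[R]_n) : P - a - (Q - b) = P - Q + (b - a).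
  by apply/rowP => i; rewrite !mxE; ring.
rewrite aux -scalerBr; congr (_ + _ *: _).
move: (v *m J x) (u *m J x) (B x *m J x) => vJ uJ BJ.
by apply/rowP => i; rewrite !mxE; ring.
Qed.

End LeeJ.

Section CovAlong.
Variables (R : realType) (m n : nat) (M : manifold R m) (N : manifold R n).
Variables (J g : N -> 'M[R]_n) (omega : N -> 'cV[R]_n) (B : N -> 'rV[R]_n).
Hypothesis lcg : lck J g.
Hypothesis lee : lee_form J g omega.
Hypothesis leeB : lee_vector g omega B.

(** The Christoffel term of J V in the product rule cancels against the one in [lck_diffJ], so the
    formula for the derivative of J holds along an arbitrary map. *)
Lemma cov_lckJ (f : M -> N) x V u : mapdiff f x -> field_mdiff f x V ->
  field_mdiff f x (fun z => V z *m J (f z)) /\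
  cov g f u (fun z => V z *m J (f z)) x =
    cov g f u V x *m J (f x) +
    lee_correction J g omega B (f x) (tmap f x u) (V x).
Proof.
move=> df dV; have [sg pg dg dJ] := lck_metric lcg.
have [h1 h2] := cov_endo g df (dJ _) u dV; split=> //.
rewrite h2 (lck_diffJ lcg lee leeB) covE mulmxDl.
have aux (a b c d : 'rV[R]_n) : a + (b - c + d) + c = a + b + d.
  by apply/rowP => k; rewrite !mxE; ring.
exact: aux.
Qed.

End CovAlong.

(** * Derivatives along a composite map *)

Section Composite.
Variables (R : realType) (l m n : nat).
Variables (L : manifold R l) (M : manifold R m) (N : manifold R n).
Variables (i : L -> M) (f : M -> N) (y : L).
Hypothesis di : mapdiff i y.

Lemma cov_comp g u V : mapdiff f (i y) -> field_mdiff f (i y) V ->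
  field_mdiff (f \o i) y (V \o i) /\
  cov g (f \o i) u (V \o i) y = cov g f (tmap i y u) V (i y).
Proof.
move=> df dV; have [h1 h2] := fdiff_comp di dV; split=> //.
by rewrite !covE tmap_comp//; congr (_ + _); exact: h2.
Qed.

Hypothesis sf : smooth_map f.

(** In coordinates the field is a sum of components of [S] times partial derivatives of [f].
    Differentiating the partial derivatives yields terms multiplied by the components of [S y], and
    these disappear when [S y = 0]. *)
Lemma tmap_field_local S u : field_mdiff i y S ->
  field_mdiff (f \o i) y (fun z => tmap f (i z) (S z)) /\
  (S y = 0 ->
   fdiff (fun z => comp_in (f (i y)) (f (i z)) (tmap f (i z) (S z))) y u =
   tmap f (i y) (fdiff (fun z => comp_in (i y) (i z) (S z)) y u)).
Proof.
move=> dS; set p := i y; set q := f p.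
pose fh := cd q \o f \o pm p.
(* Order 2, because the partial derivatives of [f] occur as coefficients and have to be
   differentiated once more. *)
have [fd1 fd2] := sf.2 q p 2.
have py : (cd p @` (dm p `&` f @^-1` dm q)) (cd p p).
  exact: (mem_chart_image (chart_at_dom p) (chart_at_dom q)).
have near_q : \forall z \near y, dm p (i z) /\ dm q (f (i z)).
  have h : \forall z \near p, dm p z /\ dm q (f z).
    apply: filterI; first exact: near_dom.
    exact: near_fdom (smooth_mapdiff p sf).
  by case: di => ci _; exact: ci h.
pose D j (w : M) := 'D_(delta_mx 0 j) fh (cd p w).
have e : \forall z \near y, comp_in q (f (i z)) (tmap f (i z) (S z)) =
    \sum_j (comp_in p (i z) (S z) 0 j : R^o) *: D j (i z).
  apply: filterS near_q => z [pz qz].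
  have df := smooth_mapdiff (i z) sf.
  have [h1 h2] := tmap_chart qz df.
  rewrite -[LHS]h2 (fdiff_chart _ pz h1) diff_sum_delta.
  apply: eq_bigr => j _; congr (_ *: _).
  exact: esym (hasdiff_derive _ (differentiable_hasdiff ((mdiff_chart _ pz).2 h1))).
have dD j : mdiff (D j) p.
  have h := differentiable_hasdiff ((fd2 (delta_mx 0 j)).1 _ py).
  apply: (near_hasdiff _ h).1.
  by apply: filterS (chart_nearK (chart_at_dom p)) => w /= hw; rewrite /D hw.
have hD j := (fdiff_comp di (dD j)).1.
have hS j := fdiff_coord 0 j dS.
have hj j := fdiff_scale (hS j).1 (hD j).
have [h1 h2] := fdiff_sum (index_enum 'I_m) (fun j => (hj j).1).
have [h3 h4] := near_fdiff e h1.
split=> // Sy; rewrite h4 h2.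
set w := fdiff _ y u.
have -> : tmap f p w = \sum_j w 0 j *: 'd fh (cd p p) (delta_mx 0 j).
  exact: diff_sum_delta.
apply: eq_bigr => j _; rewrite (hj j).2 (hS j).2 Sy.
have -> : comp_in p (i y) 0 = 0 by exact: comp_in_center.
rewrite mxE scale0r addr0; congr (_ *: _).
exact: hasdiff_derive (differentiable_hasdiff (fd1 _ py)).
Qed.

Lemma tmap_field_mdiff S : field_mdiff i y S ->
  field_mdiff (f \o i) y (fun z => tmap f (i z) (S z)).
Proof. by move=> h; have [] := tmap_field_local 0 h. Qed.

(* Tensoriality of the second fundamental form: the derivative of a field tangent
   to [M] depends, modulo vectors tangent to [M], only on the value of the field
   at the point. *)
Lemma cov_tmap_vanishing g S u : field_mdiff i y S -> S y = 0 ->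
  tangent_space f (i y) (cov g (f \o i) u (fun z => tmap f (i z) (S z)) y).
Proof.
move=> dS Sy; exists (fdiff (fun z => comp_in (i y) (i z) (S z)) y u) => //.
rewrite covE [X in X + _]((tmap_field_local u dS).2 Sy) Sy.
have -> : tmap f (i y) 0 = 0 by rewrite /tmap /fdiff linear0.
rewrite [X in _ + X](_ : _ = 0) ?addr0//.
apply/rowP => k; rewrite !mxE big1// => a _; rewrite big1// => b _.
by rewrite mxE mulr0.
Qed.

End Composite.

(** * Orthogonal projections and sections of distributions *)

Section OrthProj.
Variables (R : realType) (n : nat) (G : 'M[R]_n).
Hypothesis symG : forall u v, inner G u v = inner G v u.
Hypothesis posG : forall u, u != 0 -> 0 < inner G u u.

Definition subspace_set (S : set 'rV[R]_n) : Prop :=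
  S 0 /\ forall a u v, S u -> S v -> S (a *: u + v).

(** Take a matrix of maximal rank whose row space lies in [S]. A vector of [S] outside this row
    space could be added to it and would raise the rank. *)
Lemma subspace_row_free (S : set 'rV[R]_n) : subspace_set S ->
  exists d (A : 'M[R]_(d, n)), row_free A /\ S = [set c *m A | c in setT].
Proof.
move=> [S0 SD].
pose P k := `[< exists A : 'M[R]_n, \rank A = k /\ forall c, S (c *m A) >].
have P0 : exists k, P k.
  exists 0%N; apply/asboolP; exists 0; rewrite mxrank0; split=> // c.
  by rewrite mulmx0.
have Pn k : P k -> (k <= n)%N by move=> /asboolP[A [<- _]]; exact: rank_leq_row.
case: (ex_maxnP P0 Pn) => k /asboolP[A [rA SA]] kmax.
exists (\rank A), (row_base A); split; first exact: row_base_free.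
have Se v : S v <-> (v <= A)%MS.
  split=> [Sv|/submxP[c ->]//]; apply/negPn/negP => vA.
  have lt : (\rank A < \rank (A + v)%MS)%N.
    by rewrite ltn_neqAle mxrankS ?addsmxSl// andbT; apply: contra vA => /eqP e;
      apply: submx_trans (addsmxSr A v) _; rewrite -(geq_leqif (mxrank_leqif_sup (addsmxSl A v))) e.
  have : P (\rank (A + v)%MS).
    apply/asboolP; exists (A + v)%MS; split=> // c.
    have /sub_addsmxP[[c1 c2] ->] := submxMl c (A + v)%MS.
    rewrite [c2]mx11_scalar mul_scalar_mx addrC /=.
    by apply: SD => //; exact: SA.
  by move=> /kmax; rewrite leqNgt -rA lt.
apply/seteqP; split=> v.
  by move=> /Se; rewrite -(eq_row_base A) => /submxP[c ->]; exists c.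
by move=> [c _ <-]; apply/Se; rewrite (submx_trans (submxMl _ _))// eq_row_base.
Qed.

Lemma orth_proj_exists (S : set 'rV[R]_n) w : subspace_set S ->
  exists s, S s /\ forall t, S t -> inner G (w - s) t = 0.
Proof.
move=> /subspace_row_free[d [A [fA ->]]].
pose P := A *m G *m A^T.
have uP : P \in unitmx.
  rewrite -row_free_unit -kermx_eq0; apply/negPn/negP => /rowV0Pn[c /sub_kermxP h c0].
  have : inner G (c *m A) (c *m A) = 0.
    by rewrite /inner trmx_mul -!mulmxA -/(A *m _) !mulmxA -2!(mulmxA c) h mul0mx mxE.
  have cA : c *m A != 0.
    by apply: contra c0 => /eqP e; rewrite -(mulmx_free_eq0 c fA) e.
  by move: (posG cA) => /[swap] ->; rewrite ltxx.
(* The usual formula for the projection onto the row space of [A], with [P] the Gram matrix of its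
   rows. *)
exists (w *m G *m A^T *m invmx P *m A); split; first by eexists.
move=> _ [c _ <-]; rewrite innerBl.
suff -> : inner G w (c *m A) = inner G (w *m G *m A^T *m invmx P *m A) (c *m A).
  by rewrite subrr.
rewrite /inner trmx_mul !mulmxA; congr ((_ *m _) 0 0).
set X := w *m G *m A^T.
have -> : X *m invmx P *m A *m G *m A^T = X *m (invmx P *m P).
  by rewrite /P !mulmxA.
by rewrite mulVmx// mulmx1.
Qed.

Lemma orth_projP (S : set 'rV[R]_n) w : subspace_set S ->
  S (orth_proj G S w) /\ forall t, S t -> inner G (w - orth_proj G S w) t = 0.
Proof. by move=> /(orth_proj_exists w) h; have := xgetPex 0 h. Qed.

Lemma orth_proj_inner (S : set 'rV[R]_n) w t : subspace_set S -> S t ->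
  inner G (orth_proj G S w) t = inner G w t.
Proof.
move=> sS St; have [_ h] := orth_projP w sS.
by apply/eqP; rewrite eq_sym -subr_eq0 -innerBl h.
Qed.

Lemma subspace_setB (S : set 'rV[R]_n) u v : subspace_set S -> S u -> S v -> S (u - v).
Proof. by move=> [S0 SD] Su Sv; rewrite addrC -scaleN1r; exact: SD. Qed.

Lemma subspace_setZ (S : set 'rV[R]_n) a u : subspace_set S -> S u -> S (a *: u).
Proof. by move=> [S0 SD] Su; rewrite -[_ *: _]addr0; exact: SD. Qed.

Lemma inner_eq_on (S : set 'rV[R]_n) u v : subspace_set S -> S u -> S v ->
  (forall t, S t -> inner G u t = inner G v t) -> u = v.
Proof.
move=> sS Su Sv h; apply/eqP; rewrite -subr_eq0; apply/negPn/negP => /posG.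
have Suv := subspace_setB sS Su Sv.
by rewrite {1}innerBl h// subrr ltxx.
Qed.

Lemma orth_proj_eq (S : set 'rV[R]_n) w s : subspace_set S -> S s ->
  (forall t, S t -> inner G s t = inner G w t) -> orth_proj G S w = s.
Proof.
move=> sS Ss h; apply: (inner_eq_on sS) => //; first by have [] := orth_projP w sS.
by move=> t St; rewrite orth_proj_inner// h.
Qed.

(** A subspace is its own double orthogonal complement. This turns the vanishing of a second
    fundamental form, defined by projection, into tangency of the ambient derivative. *)
Lemma orth_proj0 (S : set 'rV[R]_n) w : subspace_set S ->
  orth_proj G [set v | forall t, S t -> inner G v t = 0] w = 0 <-> S w.
Proof.
move=> sS; set S' := [set _ | _].
have sS' : subspace_set S'.
  split=> [t _|a u v hu hv t St]; first exact: inner0l.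
  by rewrite innerDl innerZl hu// hv// mulr0 addr0.
split=> [h|Sw]; last first.
  apply: orth_proj_eq => //; first by case: sS'.
  by move=> t /(_ w Sw) h; rewrite inner0l symG h.
have [Ss hs] := orth_projP w sS; set s := orth_proj G S w in Ss hs.
have hw : S' (w - s) by [].
(* Since [w - s] is orthogonal to [S], its product with itself equals its product with [w], which
   only sees the projection of [w] onto the complement. *)
have : inner G (w - s) (w - s) = 0.
  rewrite {1}innerBl (symG s) hw// subr0 -(orth_proj_inner _ sS' hw) h.
  exact: inner0l.
case: (eqVneq (w - s) 0) => [/eqP|/posG + e]; last by rewrite e ltxx.
by rewrite subr_eq0 => /eqP ->.
Qed.

End OrthProj.

Section TangentLinear.
Variables (R : realType) (m n : nat) (M : manifold R m) (N : manifold R n).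
Variables (f : M -> N) (x : M).

Lemma tmap0 : tmap f x 0 = 0.
Proof. by rewrite /tmap /fdiff linear0. Qed.
Lemma tmapP a u v : tmap f x (a *: u + v) = a *: tmap f x u + tmap f x v.
Proof. exact: tmap_linear. Qed.
Lemma tmapB u v : tmap f x (u - v) = tmap f x u - tmap f x v.
Proof. by rewrite addrC -scaleN1r tmapP scaleN1r addrC. Qed.
Lemma tmapZ a u : tmap f x (a *: u) = a *: tmap f x u.
Proof. by rewrite -[a *: u]addr0 tmapP tmap0 addr0. Qed.
Lemma tmap_sum I (s : seq I) (u : I -> 'rV[R]_m) :
  tmap f x (\sum_(i <- s) u i) = \sum_(i <- s) tmap f x (u i).
Proof.
elim: s => [|i s ih]; first by rewrite !big_nil tmap0.
by rewrite !big_cons -ih -{1}[u i]scale1r tmapP scale1r.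
Qed.

End TangentLinear.

(** * Extension of vectors to sections of D and of its complement *)

Section Sections.
Variables (R : realType) (m n r : nat) (M : manifold R m) (N : manifold R n).
Variables (g : N -> 'M[R]_n) (f : M -> N) (D : M -> {vspace 'rV[R]_m}).
Hypothesis rg : riemannian_on setT g.
Hypothesis imf : immersion f.
Hypothesis dD : distribution r D.

Lemma span_sum (X : 'I_r -> 'rV[R]_m) u :
  u \in <<[seq X i | i <- enum 'I_r]>>%VS -> exists c : 'I_r -> R, u = \sum_i c i *: X i.
Proof.
move=> hu; pose T := [tuple X i | i < r].
exists (vector.coord T ^~ u); rewrite {1}(@coord_span _ _ _ T u); last first.
  by move: hu; rewrite /T /=.
by apply: eq_bigr => i _; rewrite -tnth_nth tnth_mktuple.
Qed.

Lemma section_D_extension x u : u \in D x ->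
  exists2 Y, section_D D Y & Y x = u.
Proof.
have [U [E [oU Ux hE DE]]] := dD x.
have [_ ->] := DE x Ux; move=> /span_sum[c ->].
have hs : vector_field_on U (fun z => \sum_i c i *: E i z).
  apply: (field_along_sum (smooth_id M) _ oU) => i.
  exact: (field_along_scale (smooth_id M) oU (msmooth_cst U (c i : R^o)) (hE i)).
have [b [b1 [hb b0]]] := field_globalize oU Ux hs.
exists (fun z => b z *: \sum_i c i *: E i z); last by rewrite b1 scale1r.
split=> // z; have [Uz|Uz] := pselect (U z); last by rewrite b0// scale0r mem0v.
have [_ ->] := DE z Uz; apply/memvZ/memv_suml => i _; apply/memvZ/memv_span.
by apply/mapP; exists i => //; rewrite mem_enum.
Qed.

Local Notation ind := (induced_metric g f).

Lemma inducedDl x u v w a : ind x (a *: u + v) w = a * ind x u w + ind x v w.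
Proof. by rewrite /induced_metric tmapP innerDl innerZl. Qed.
Lemma inducedC x u v : ind x u v = ind x v u.
Proof. by case: rg => h _ _; exact: h. Qed.
Lemma induced_suml x I (s : seq I) (u : I -> 'rV[R]_m) v :
  ind x (\sum_(i <- s) u i) v = \sum_(i <- s) ind x (u i) v.
Proof. by rewrite /induced_metric tmap_sum inner_suml. Qed.
Lemma inducedZl x a u v : ind x (a *: u) v = a * ind x u v.
Proof. by rewrite /induced_metric tmapZ innerZl. Qed.
Lemma induced_smooth U V W : open U -> vector_field_on U V -> vector_field_on U W ->
  msmooth_on U (fun z => ind z (V z) (W z) : R^o).
Proof.
move=> oU hV hW; have [sf _] := imf.
by apply: (inner_smooth sf oU rg); exact: push_smooth.
Qed.

(* Cramer's rule: [V'] is [\det G] times the orthogonal projection of [V] to the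
   complement of the frame [E], where [G] is the Gram matrix of [E]. *)
Lemma section_Dperp_extension x v : Dperp g f D x v ->
  exists2 X, section_Dperp g f D X & X x = v.
Proof.
move=> Dv; have [U [E [oU Ux hE DE]]] := dD x.
have [V hV Vx] := vector_field_extension x v.
have {}hV : vector_field_on U V by exact: field_along_sub (@subsetT _ _) hV.
pose G z := \matrix_(i < r, j < r) ind z (E i z) (E j z).
pose V' z := (\det (G z) : R^o) *: V z + \sum_j
   ((- \sum_i ind z (V z) (E i z) * \adj (G z) i j) : R^o) *: E j z.
have sG i j : msmooth_on U (fun z => G z i j : R^o).
  by apply: msmooth_cong (induced_smooth oU (hE i) (hE j)) => // z _; rewrite mxE.
have hV' : vector_field_on U V'.
  apply: (field_alongD (smooth_id M) oU).
    exact: (field_along_scale (smooth_id M) oU (msmooth_det oU sG) hV).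
  apply: (field_along_sum (smooth_id M) _ oU) => j.
  apply: (field_along_scale (smooth_id M) oU _ (hE j)).
  apply: (msmooth_cong oU (F := fun z => \sum_i
      (- ind z (V z) (E i z) : R^o) *: (\adj (G z) i j : R^o) : R^o)).
    by move=> z _; rewrite -sumrN; apply: eq_bigr => i _; rewrite -mulNr.
  apply: (msmooth_sum oU) => i; apply: (msmooth_scale oU); last exact: msmooth_adj.
  apply: (msmooth_cong oU _ (msmooth_scale oU (msmooth_cst U (-1 : R^o))
    (induced_smooth oU hV (hE i)))) => z _.
  by rewrite scaleN1r.
have V'E z k : ind z (V' z) (E k z) = 0.
  rewrite /V' inducedDl induced_suml.
  have -> : \sum_j ind z (((- \sum_i ind z (V z) (E i z) * \adj (G z) i j) : R^o) *: E j z) (E k z)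
     = - \sum_i ind z (V z) (E i z) * (\adj (G z) *m G z) i k.
    under eq_bigr do rewrite inducedZl mulNr mulr_suml.
    rewrite sumrN exchange_big; congr (- _); apply: eq_bigr => i _.
    rewrite mxE mulr_sumr; apply: eq_bigr => l _.
    by rewrite mulrA [G z l k]mxE.
  rewrite mul_adj_mx (bigD1 k)//= big1 => [|i ik]; last first.
    by rewrite mxE (negbTE ik) mulr0n mulr0.
  by rewrite addr0 mxE eqxx mulr1n mulrC subrr.
have perpV' z : U z -> Dperp g f D z (V' z).
  move=> Uz u; have [_ ->] := DE z Uz; move=> /span_sum[c ->].
  rewrite induced_suml big1// => i _.
  by rewrite inducedZl inducedC V'E mulr0.
(* At [x] the vector [v] is already orthogonal to the frame, so only the determinant factor
   remains. *)
have V'x : V' x = \det (G x) *: v.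
  rewrite /V' Vx big1 ?addr0// => j _; rewrite big1 ?oppr0 ?scale0r// => i _.
  rewrite inducedC Dv ?mul0r//; have [_ ->] := DE x Ux.
  by apply/memv_span/mapP; exists i => //; rewrite mem_enum.
(* A kernel vector of the Gram matrix gives a combination of the frame of length 0. It vanishes
   because [f] is an immersion, and the frame is free because it has [r] members and spans dimension
   [r]. *)
have detG : \det (G x) != 0.
  rewrite -unitfE -unitmxE -row_free_unit -kermx_eq0.
  apply/negPn/negP => /rowV0Pn[c /sub_kermxP h c0].
  pose u := \sum_i c 0 i *: E i x.
  have u0 : ind x u u = 0.
    rewrite {2}/u inducedC induced_suml big1// => j _.
    rewrite inducedZl inducedC /u induced_suml.
    have := congr1 (fun A : 'rV[R]_r => A 0 j) h; rewrite !mxE => e.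
    have -> : \sum_i ind x (c 0 i *: E i x) (E j x) = 0.
      by apply: etrans e; apply: eq_bigr => i _; rewrite inducedZl mxE.
    exact: mulr0.
  have {}u0 : u = 0.
    have [_ inj] := imf; apply: (inj x); rewrite tmap0; apply/eqP/negPn/negP.
    have [_ pg _] := rg => /(pg (f x) Logic.I).
    by move: u0; rewrite /induced_metric => ->; rewrite ltxx.
  have [dimD spanD] := DE x Ux.
  have fE : free [seq E i x | i <- enum 'I_r].
    by rewrite /free -spanD dimD size_map size_enum_ord.
  move: c0 => /negP; apply; apply/eqP/rowP => i; rewrite mxE.
  have fT : free [tuple E i x | i < r] by [].
  move/freeP: fT => /(_ (fun i => c 0 i)); apply.
  by rewrite -[RHS]u0; apply: eq_bigr => j _; rewrite -tnth_nth tnth_mktuple.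
(* The constant inverse of the determinant at [x] restores the prescribed value. *)
have [b [b1 [hb b0]]] := field_globalize oU Ux
  (field_along_scale (smooth_id M) oU (msmooth_cst U ((\det (G x))^-1 : R^o)) hV').
exists (fun z => b z *: (((\det (G x))^-1 : R^o) *: V' z)); last first.
  by rewrite b1 scale1r V'x scalerA mulVf// scale1r.
split=> // z u Du; rewrite inducedC inducedZl.
have [Uz|/b0 ->] := pselect (U z); last by rewrite mul0r.
by rewrite inducedZl inducedC perpV'// !mulr0.
Qed.

End Sections.

(** * CR-submanifolds *)

Section CR.
Variables (R : realType) (n m r : nat) (N : manifold R n) (M : manifold R m).
Variables (J g : N -> 'M[R]_n) (omega : N -> 'cV[R]_n) (B : N -> 'rV[R]_n).
Variables (f : M -> N) (D : M -> {vspace 'rV[R]_m}).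
Hypothesis lcg : lck J g.
Hypothesis lee : lee_form J g omega.
Hypothesis leeB : lee_vector g omega B.
Hypothesis CR : CR_submanifold J g f r D.

Local Notation ip x := (inner (g (f x))).
Local Notation Jf x := (J (f x)).
Local Notation Dp := (Dperp g f D).
Local Notation theta x v := (anti_lee_form J omega (f x) v).

Let symg z : forall u v, inner (g z) u v = inner (g z) v u.
Proof. by case: (lck_metric lcg) => h _ _ _; exact: h. Qed.

Let posg z : forall u, u != 0 -> 0 < inner (g z) u u.
Proof. by case: (lck_metric lcg) => _ h _ _; exact: h. Qed.

Let rg : riemannian_on setT g.
Proof. by case: lcg => -[]. Qed.

Let imf : immersion f. Proof. by case: CR. Qed.
Let sf : smooth_map f. Proof. by case: imf. Qed.
Let dD : distribution r D. Proof. by case: CR. Qed.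

Lemma J_sq z (u : 'rV[R]_n) : u *m J z *m J z = - u.
Proof.
case: lcg => -[_ _ h _] _.
by rewrite -mulmxA h// mulmxN mulmx1.
Qed.

Lemma J_skew z u v : inner (g z) (u *m J z) v = - inner (g z) u (v *m J z).
Proof.
case: lcg => -[_ _ _ h] _.
by rewrite -(h z Logic.I u) J_sq innerNr opprK.
Qed.

Lemma J_isometry z u v : inner (g z) (u *m J z) (v *m J z) = inner (g z) u v.
Proof. by case: lcg => -[_ _ _ h] _; exact: h. Qed.

Lemma Dperp_J_normal x v u : Dp x v -> ip x (tmap f x v *m Jf x) (tmap f x u) = 0.
Proof.
move=> Dv; case: CR => _ _ _ h; apply: (h x); last by exists u.
by exists v.
Qed.

Lemma D_Dperp x u v : u \in D x -> Dp x v -> ip x (tmap f x u) (tmap f x v) = 0.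
Proof. by move=> Du; exact. Qed.

Lemma D_J x u : u \in D x -> exists2 u', u' \in D x & tmap f x u *m Jf x = tmap f x u'.
Proof.
move=> Du; case: CR => _ _ h _.
have : [set tmap f x v *m J (f x) | v in [set` D x]] (tmap f x u *m Jf x) by exists u.
by rewrite h => -[u' ? <-]; exists u'.
Qed.

Lemma D_J_onto x u : u \in D x -> exists2 u', u' \in D x & tmap f x u = tmap f x u' *m Jf x.
Proof.
move=> Du; case: CR => _ _ h _.
have : [set tmap f x v | v in [set` D x]] (tmap f x u) by exists u.
by rewrite -h => -[u' ? <-]; exists u'.
Qed.

Lemma subspace_normal x : subspace_set (normal_space g f x).
Proof.
split=> [t _|a u v hu hv t Tt]; first exact: inner0l.
by rewrite innerDl innerZl hu// hv// mulr0 addr0.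
Qed.

Lemma subspace_tangent x : subspace_set (tangent_space f x).
Proof.
split=> [|a _ _ [u _ <-] [v _ <-]]; first by exists 0 => //; rewrite tmap0.
by exists (a *: u + v) => //; rewrite tmapP.
Qed.

Lemma subspace_JDperp x : subspace_set (JDperp J g f D x).
Proof.
split=> [|a _ _ [u Du <-] [v Dv <-]].
  exists 0; last by rewrite tmap0 mul0mx.
  by move=> u _; rewrite /induced_metric tmap0 inner0r.
exists (a *: u + v); last by rewrite tmapP mulmxDl scalemxAl.
move=> w Dw; rewrite /induced_metric tmapP innerDr innerZr.
by rewrite (D_Dperp Dw Du) (D_Dperp Dw Dv) mulr0 addr0.
Qed.

Lemma subspace_mu x : subspace_set (mu_space J g f D x).
Proof.
have sn := subspace_normal x; split.
  by split; [exact: sn.1|move=> t _; exact: inner0l].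
move=> a u v [nu hu] [nv hv]; split; first exact: sn.2.
by move=> t Tt; rewrite innerDl innerZl hu// hv// mulr0 addr0.
Qed.

(** J w is orthogonal to J D^perp because J is an isometry and w is normal. It is orthogonal to TM
    because a tangent vector splits into a part in D, which J preserves, and a part in D^perp, which
    J sends into the complement of mu. *)
Lemma mu_J x w : mu_space J g f D x w -> mu_space J g f D x (w *m Jf x).
Proof.
move=> [nw pw]; split=> [_ [u _ <-]|_ [v Dv <-]]; last first.
  by rewrite J_isometry; apply: nw; exists v.
have sD : subspace_set [set tmap f x v | v in [set` D x]].
  split=> [|a _ _ [c Dc <-] [d Dd <-]].
    by exists 0; [exact: mem0v|rewrite tmap0].
  by exists (a *: c + d); [apply: memvD => //; exact: memvZ|rewrite tmapP].
have [[d Dd dE] h] := orth_projP (@posg (f x)) (tmap f x u) sD.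
rewrite -dE in h.
have Dud : Dp x (u - d).
  move=> c Dc; rewrite /induced_metric tmapB symg; apply: h; by exists c.
rewrite J_skew.
have -> : tmap f x u = tmap f x d + tmap f x (u - d) by rewrite tmapB addrC subrK.
have [d' Dd' dE'] := D_J Dd.
rewrite mulmxDl innerDr dE' nw; last by exists d'.
by rewrite pw ?addr0 ?oppr0//; exists (u - d).
Qed.

Lemma normal_inner_h X Y x nu : normal_space g f x nu ->
  ip x (second_ff g f X Y x) nu = ip x (cov g f (X x) (push f Y) x) nu.
Proof. by move=> h; apply: (orth_proj_inner (@posg (f x)) _ (subspace_normal x)). Qed.

Lemma JDperp_normal x v : Dp x v -> normal_space g f x (tmap f x v *m Jf x).
Proof. by move=> Dv _ [u _ <-]; exact: Dperp_J_normal. Qed.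

Lemma inner_anti_lee_vector x w :
  ip x (anti_lee_vector J B (f x)) w = theta x w.
Proof.
by rewrite /anti_lee_vector innerNl J_skew opprK symg leeB.
Qed.

Let mapdf x : mapdiff f x := smooth_mapdiff x sf.

(** * Fields along a leaf *)

Section Along.
Variables (l : nat) (L : manifold R l) (i : L -> M).
Hypothesis si : smooth_map i.
Let mapdi y : mapdiff i y := smooth_mapdiff y si.
Hypothesis iD : forall y u, Dp (i y) (tmap i y u).

Variable Z : L -> 'rV[R]_l.
Hypothesis hZ : vector_field Z.

Let iZ y := tmap i y (Z y).

Lemma push_along_mdiff y : field_mdiff i y iZ.
Proof.
apply: (@tmap_field_mdiff _ _ _ _ _ _ _ (fun z : L => z) i y (mapdiff_id y) si Z).
exact: field_along_mdiff hZ.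
Qed.

Lemma push_comp : push (f \o i) Z = (fun y => tmap f (i y) (iZ y)).
Proof. by apply/funext => y; rewrite /push tmap_comp. Qed.

(** The difference of the two fields along [i] is tangent to M and vanishes at [y], so its
    derivative there is tangent to M. Thus the part of the leaf derivative normal to M can be
    computed with any field on M through the same vector. *)
Lemma cov_comp_tangent y u Y : vector_field Y -> Y (i y) = iZ y ->
  tangent_space f (i y) (cov g (f \o i) u (push (f \o i) Z) y -
                         cov g f (tmap i y u) (push f Y) (i y)).
Proof.
move=> hY Yy; rewrite push_comp.
have dZ := push_along_mdiff y.
have dY : field_mdiff (fun z : M => z) (i y) Y by exact: field_along_mdiff hY.
have [dYi _] := cov_comp (mapdi y) (fun=> 0) u (mapdiff_id (i y)) dY.
have dfY : field_mdiff f (i y) (push f Y) :=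
  tmap_field_mdiff (mapdiff_id (i y)) sf dY.
have [dfYi <-] := cov_comp (mapdi y) g u (mapdf (i y)) dfY.
have dfZ := tmap_field_mdiff (mapdi y) sf dZ.
rewrite -(covB g u dfZ dfYi).
have -> : (fun z => tmap f (i z) (iZ z) - (push f Y \o i) z) =
    (fun z => tmap f (i z) (iZ z - Y (i z))).
  by apply/funext => z; rewrite tmapB.
apply: (cov_tmap_vanishing (mapdi y) sf); last by rewrite Yy subrr.
exact: (field_mdiffB dZ dYi).
Qed.

Lemma cov_D_component y u Y : section_D D Y ->
  ip (i y) (cov g (f \o i) u (push (f \o i) Z) y)
           (tmap f (i y) (Y (i y)) *m Jf (i y)) =
  ip (i y) (tmap f (i y) (iZ y) *m Jf (i y))
           (cov g f (tmap i y u) (push f Y) (i y)) -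
    2^-1 * theta (i y) (tmap f (i y) (Y (i y))) *
    ip (i y) (tmap f (i y) (tmap i y u)) (tmap f (i y) (iZ y)).
Proof.
move=> [hY DY]; set x := i y.
set w := tmap f x (Y x); set v := tmap f x (iZ y).
have mfi : mapdiff (f \o i) y := mapdiff_comp (mapdi y) (mapdf x).
have dfZ : field_mdiff (f \o i) y (push (f \o i) Z).
  have h := tmap_field_mdiff (mapdi y) sf (push_along_mdiff y).
  by rewrite push_comp; exact: h.
have dY : field_mdiff (fun z : M => z) x Y by exact: field_along_mdiff hY.
have dfY : field_mdiff f x (push f Y) := tmap_field_mdiff (mapdiff_id x) sf dY.
have [dfYi covY] := cov_comp (mapdi y) g u (mapdf x) dfY.
have [dJZ covJZ] := cov_lckJ lcg lee leeB u mfi dfZ.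
have [sg _ dg _] := lck_metric lcg.
have := cov_metric mfi (dg _) sg (@posg _) u dJZ dfYi.
(* The differentiated function is identically 0 on the leaf: J sends D^perp into the normal bundle,
   whereas [Y] is tangent. *)
have -> : (fun z => inner (g ((f \o i) z)) (push (f \o i) Z z *m J ((f \o i) z))
    ((push f Y \o i) z) : R^o) = fun=> 0.
  apply/funext => z; rewrite push_comp.
  exact: (Dperp_J_normal (Y (i z)) (iD (Z z))).
rewrite fdiff_cst covY covJZ.
have -> : push (f \o i) Z y = v by rewrite push_comp.
have -> : tmap (f \o i) y u = tmap f x (tmap i y u) by rewrite tmap_comp.
have Dv : Dp x (iZ y) := iD (Z y).
have Du : Dp x (tmap i y u) := iD u.
rewrite -[(f \o i) y]/(f x) -[(push f Y \o i) y]/w.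
(* Of the four correction terms only the one in A survives: D and D^perp are orthogonal, and J
   D^perp is orthogonal to TM. The product of A with a vector is theta of that vector. *)
rewrite /lee_correction innerDl innerZl !innerBl !innerZl.
rewrite (symg (f x) (tmap f x (tmap i y u)) w) (D_Dperp (DY x) Du).
have hv : ip x (tmap f x (tmap i y u)) (v *m Jf x) = 0.
  by rewrite symg; exact: Dperp_J_normal.
rewrite (Dperp_J_normal (Y x) Du) hv.
rewrite inner_anti_lee_vector J_skew.
move: (ip x (cov _ _ _ _ _) _) (ip x (v *m Jf x) _) (ip x _ v) (theta x w) => a b c d.
lra.
Qed.

End Along.

(** Skew-symmetry moves J onto [nu]. Again only the term in A survives, now because [nu] is normal
    and orthogonal to J D^perp, and J Z is normal. *)
Lemma cov_J_mu X Z x nu : section_Dperp g f D X -> section_Dperp g f D Z ->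
  mu_space J g f D x nu ->
  ip x (cov g f (X x) (fun x' => tmap f x' (Z x') *m Jf x') x) nu =
  - ip x (cov g f (X x) (push f Z) x) (nu *m Jf x) -
    2^-1 * induced_metric g f x (X x) (Z x) * ip x (anti_lee_vector J B (f x)) nu.
Proof.
move=> [hX DX] [hZ DZ] [nnu pnu].
have dZ : field_mdiff (fun z : M => z) x Z by exact: field_along_mdiff hZ.
have dfZ : field_mdiff f x (push f Z) := tmap_field_mdiff (mapdiff_id x) sf dZ.
have [_ ->] := cov_lckJ lcg lee leeB (X x) (mapdf x) dfZ.
rewrite /lee_correction innerDl innerZl !innerBl !innerZl -[push f Z x]/(tmap f x (Z x)).
rewrite (symg (f x) (tmap f x (X x)) nu) nnu; last by exists (X x).
rewrite (symg (f x) (tmap f x (X x) *m Jf x) nu) pnu; last by exists (X x).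
have hv : ip x (tmap f x (X x)) (tmap f x (Z x) *m Jf x) = 0.
  by rewrite symg; exact: Dperp_J_normal.
rewrite hv J_skew /induced_metric.
by rewrite !mulr0 mul0r !subr0 sub0r mulrN mulrA.
Qed.

End CR.

(** * The equivalences *)

Theorem theorem3p7 (R : realType) (n m r k : nat)
    (N : manifold R n) (J g : N -> 'M[R]_n)
    (omega : N -> 'cV[R]_n) (B : N -> 'rV[R]_n)
    (M : manifold R m) (f : M -> N) (D : M -> {vspace 'rV[R]_m})
    (F : foliation (Dperp g f D) k) :
  lck J g -> lee_form J g omega -> lee_vector g omega B ->
  CR_submanifold J g f r D ->
  let theta := anti_lee_form J omega in
  let A := anti_lee_vector J B in
  let h := second_ff g f in
  let GD := section_D D in
  let GDperp := section_Dperp g f D in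
  let proj_JDperp x := orth_proj (g (f x)) (JDperp J g f D x) in
  let proj_mu x := orth_proj (g (f x)) (mu_space J g f D x) in
  let mixed_condition :=
    forall X Y, GDperp X -> GD Y -> forall x,
      theta (f x) (tmap f x (Y x)) *: (tmap f x (X x) *m J (f x)) =
      2 *: proj_JDperp x (h X Y x) in
  let i := totally_real_ruled g f F in
  let ii := Dperp_geodesic g f D /\ mixed_condition in
  let iii :=
    [/\ mixed_condition,
        forall X Z, GDperp X -> GDperp Z -> forall x,
          mu_space J g f D x (h X Z x) &
        forall X Z, GDperp X -> GDperp Z -> forall x,
          proj_mu x
            (normal_conn g f X (fun x' => tmap f x' (Z x') *m J (f x')) x) =
          - (2^-1 * induced_metric g f x (X x) (Z x)) *: proj_mu x (A (f x))] in
  (i <-> ii) /\ (ii <-> iii).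
Proof.
move=> lcg lee leeB CR theta A h GD GDperp pJ pmu mixed i ii iii.
have [sg pg _ _] := lck_metric lcg.
have [rg _ _ _] := lcg.1.
have [imf dD _ _] := CR.
have extD := section_D_extension dD.
have extP := section_Dperp_extension rg imf dD.
have iD (a : leaf_index F) (y : leaf a) u : Dperp g f D (leaf_map y) (tmap (incl a) y u).
  by rewrite -leaf_tangent; exists u.
have iDE (a : leaf_index F) (y : leaf a) v : Dperp g f D (leaf_map y) v ->
    exists u, tmap (incl a) y u = v.
  by rewrite -leaf_tangent => -[u _ <-]; exists u.
have si (a : leaf_index F) : smooth_map (incl a) := (leaf_immersion a).1.
have onleaf x : exists (a : leaf_index F) (y : leaf a), leaf_map y = x.
  by have [a [[y _ <-] _]] := leaf_partition F x; exists a, y.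
have tphi (a : leaf_index F) (y : leaf a) u :
    tmap (f \o incl a) y u =
    tmap f (leaf_map y) (tmap (incl a) y u).
  by apply: tmap_comp; apply: smooth_mapdiff => //; exact: imf.1.
have gI x X Y : h X Y x = 0 <-> tangent_space f x (cov g f (X x) (push f Y) x).
  exact: (orth_proj0 (@sg _) (@pg _) _ (subspace_tangent f x)).
have gL (a : leaf_index F) (y : leaf a) X Y :
    second_ff g (f \o incl a) X Y y = 0 <->
    tangent_space (f \o incl a) y
     (cov g (f \o incl a) (X y) (push (f \o incl a) Y) y).
  exact: (orth_proj0 (@sg _) (@pg _) _ (subspace_tangent _ y)).
split; split.
- move=> ruled; split.
    move=> X Z [hX DX] [hZ DZ] x; have [a [y yx]] := onleaf x.
    move: (DX x) (DZ x); rewrite -yx => /iDE[u uE] /iDE[z zE].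
    have [X' hX' X'y] := vector_field_extension y u.
    have [Z' hZ' Z'y] := vector_field_extension y z.
    have /gL[w _ wE] := ruled a X' Z' hX' hZ' y.
    apply/gI; rewrite -uE.
    have := cov_comp_tangent CR (si a) hZ' u hZ (etrans (esym zE) (congr1 _ (esym Z'y))).
    rewrite -X'y -wE tphi => -[w' _ w'E].
    (* The leaf derivative is tangent to the leaf, hence to M, and differs from the derivative of
       the section by the tangent vector of [w']. *)
    exists (tmap (incl a) y w - w') => //.
    by rewrite tmapB w'E subKr.
  move=> X Y [hX DX] [hY DY] x; have [a [y yx]] := onleaf x; subst x.
  set x := leaf_map y; have [u uE] := iDE _ _ _ (DX x).
  have [X' hX' X'y] := vector_field_extension y u.
  have sJ := subspace_JDperp J g f D x.
  apply: (inner_eq_on (@pg (f x)) sJ).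
  - by apply: (subspace_setZ _ sJ); exists (X x) => //; exact: DX.
  - by apply: (subspace_setZ _ sJ); exact: (orth_projP (@pg (f x)) _ sJ).1.
  (* Both sides lie in J D^perp, so it suffices to test them against J applied to vectors tangent to
     the leaf. *)
  move=> _ [v /iDE[z <-] <-].
  have [Z' hZ' Z'y] := vector_field_extension y z.
  have /gL[w _ wE] := ruled a X' Z' hX' hZ' y.
  have := cov_D_component lcg lee leeB CR (si a) (@iD a) hZ' y u (conj hY DY).
  rewrite -X'y -wE tphi X'y uE Z'y.
  (* J Y stays in D, hence is orthogonal to the derivative, which is tangent to the leaf: the left
     side of the component formula is 0. *)
  have [d' Dd' ->] := D_J CR (DY x).
  rewrite (sg _ _ (tmap f x d')) (D_Dperp Dd' (iD a y w)) => E.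
  rewrite innerZl innerZl (orth_proj_inner (@pg (f x)) _ sJ); last first.
    by exists (tmap (incl a) y z) => //; exact: iD.
  rewrite (normal_inner_h lcg); last exact: (JDperp_normal CR (iD a y z)).
  rewrite (J_isometry lcg) (sg _ (cov _ _ _ _ _)).
  move: E; rewrite -/x /theta -mulrA.
  by move: (anti_lee_form _ _ _ _ * _) (inner _ _ (cov _ _ _ _ _)) => a1 a2; lra.
- move=> [geo mix] a X' Y' hX' hY' y; apply/gL; set x := leaf_map y.
  have [X [hX DX] Xx] := extP x _ (iD a y (X' y)).
  have [Z [hZ DZ] Zx] := extP x _ (iD a y (Y' y)).
  have := cov_comp_tangent CR (si a) hY' (X' y) hZ Zx.
  set c := cov g (f \o _) _ _ _; rewrite -/x -Xx => -[w1 _ w1E].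
  have /gI[w2 _ w2E] := geo X Z (conj hX DX) (conj hZ DZ) x.
  have cE : tmap f x (w1 + w2) = c.
    by rewrite -[w1]scale1r tmapP scale1r w1E w2E subrK.
  (* The derivative [c] is tangent to M; it is tangent to the leaf as soon as its preimage [w1 + w2]
     is orthogonal to D. *)
  suff Dw : Dperp g f D x (w1 + w2).
    by have [s sE] := iDE _ _ _ Dw; exists s => //; rewrite tphi sE.
  move=> d Dd; have [d' Dd' dE] := D_J_onto CR Dd.
  have [Y [hY DY] Yx] := extD x d' Dd'.
  have := cov_D_component lcg lee leeB CR (si a) (@iD a) hY' y (X' y) (conj hY DY).
  rewrite -/c -/x -Xx Yx -dE -cE sg /induced_metric => ->.
  (* Paired with J Z, the mixed condition states that the two terms of the D-component cancel. *)
  have := congr1 (fun w => inner (g (f x)) w (tmap f x (Z x) *m J (f x)))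
    (mix X Y (conj hX DX) (conj hY DY) x).
  have sJ := subspace_JDperp J g f D x.
  rewrite !innerZl (orth_proj_inner (@pg (f x)) _ sJ); last by exists (Z x) => //; exact: DZ.
  rewrite (normal_inner_h lcg); last exact: (JDperp_normal CR (DZ x)).
  rewrite (J_isometry lcg) (sg _ (cov _ _ _ _ _)) Zx Yx /theta -[2^-1 * _ * _]mulrA.
  by move: (anti_lee_form _ _ _ _ * _) (inner _ _ (cov _ _ _ _ _)) => a1 a2; lra.
- move=> [geo mix]; split=> // [X Z sX sZ x|X Z sX sZ x].
    by rewrite /h geo//; exact: (subspace_mu J g f D x).1.
  have sm := subspace_mu J g f D x.
  apply: (orth_proj_eq (@pg (f x)) sm).
    by apply: (subspace_setZ _ sm); exact: (orth_projP (@pg (f x)) _ sm).1.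
  move=> nu mnu; have [nnu _] := mnu.
  rewrite (orth_proj_inner (@pg (f x)) _ (subspace_normal g f x))//.
  rewrite innerZl (orth_proj_inner (@pg (f x)) _ sm)//.
  rewrite (cov_J_mu lcg lee leeB CR sX sZ mnu).
  (* J nu is again normal, so the derivative of Z may be replaced by h(X, Z), which is 0. *)
  have mJ := mu_J lcg CR mnu.
  rewrite -(normal_inner_h lcg X Z mJ.1) geo// inner0l.
  by rewrite oppr0 sub0r mulNr.
- move=> [mix hmu hnc]; split=> // X Z sX sZ x.
  have sm := subspace_mu J g f D x.
  have hm := hmu X Z sX sZ x.
  have key nu : mu_space J g f D x nu ->
      inner (g (f x)) (h X Z x) (nu *m J (f x)) = 0.
    move=> mnu; have [nnu _] := mnu.
    have := congr1 (fun w => inner (g (f x)) w nu) (hnc X Z sX sZ x).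
    rewrite /= innerZl !(orth_proj_inner (@pg (f x)) _ sm)//.
    rewrite (orth_proj_inner (@pg (f x)) _ (subspace_normal g f x))//.
    rewrite (cov_J_mu lcg lee leeB CR sX sZ mnu).
    have mJ := mu_J lcg CR mnu.
    rewrite /h (normal_inner_h lcg X Z mJ.1) -/A mulNr.
    by move=> /eqP; rewrite subr_eq addNr oppr_eq0 => /eqP.
  (* Since h(X, Z) lies in mu, so does its image under J. Taking this image for [nu] in [key] gives
     minus the squared length of h(X, Z). *)
  have mJ := mu_J lcg CR hm.
  have := key _ mJ; rewrite (J_sq lcg) innerNr => /eqP; rewrite oppr_eq0 => /eqP e.
  apply/eqP/negPn/negP => /pg; rewrite -/h => /(_ (f x)).
  by rewrite e ltxx.
Qed.
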